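(* Let $\mu$ be a $\sigma$-invariant Borel probability measure on $\Sigma_2=\{0,1\}^{\mathbb{Z}}$ whose support is uniquely ergodic (that is, the restriction of $\sigma$ to $\operatorname{supp}\mu$ has exactly one invariant Borel probability measure). Then there exists a nonempty open set $\mathcal{U}\subset\mathcal{W}$ such that for every pair of weighted shift operators $(L_0,L_1)\in\mathcal{U}$, $\mu$ is the unique maximising measure of $(L_0,L_1)$.
   Context: Let $\mathcal{H}$ be a real separable Hilbert space with orthonormal basis $\{e_i: i\in\mathbb{Z}\}$, and let $\mathcal{B}(\mathcal{H})$ be the bounded linear operators on $\mathcal{H}$ with the operator norm topology. A weighted shift operator is a bounded linear operator $L$ on $\mathcal{H}$ such that $Le_i=\alpha_i e_{i+1}$ for all $i\in\mathbb{Z}$, for some real coefficients $\alpha_i$. $\mathcal{W}\subset\mathcal{B}(\mathcal{H})^2$ denotes the set of all pairs $(L_0,L_1)$ of bounded, invertible weighted shift operators with positive coefficients (so each coefficient sequence is bounded and bounded away from zero), with the topology induced by the operator norm; openness is relative to $\mathcal{W}$. $\Sigma_2=\{0,1\}^{\mathbb{Z}}$ has the product topology and $\sigma[(x_i)_{i\in\mathbb{Z}}]=(x_{i+1})_{i\in\mathbb{Z}}$. $\mathcal{M}_\sigma$ is the set of $\sigma$-invariant Borel probability measures on $\Sigma_2$. For $(L_0,L_1)\in\mathcal{W}$, the joint spectral radius is $\varrho(L_0,L_1)=\lim_{n\to\infty}\sup_{x_1,\dots,x_n\in\{0,1\}}\|L_{x_n}\cdots L_{x_1}\|^{1/n}$.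 A measure $\mu\in\mathcal{M}_\sigma$ is a maximising measure of $(L_0,L_1)$ if $\lim_{n\to\infty}\frac1n\int\log\|L_{x_n}\cdots L_{x_1}\|\,d\mu(x)=\log\varrho(L_0,L_1)$. *)

(* Defs.v *)
From HB Require Import structures.
From mathcomp Require Import all_boot all_order all_algebra.
From mathcomp Require Import all_classical all_reals all_analysis.
Set Implicit Arguments.
Unset Strict Implicit.
Unset Printing Implicit Defensive.
Import Order.TTheory GRing.Theory Num.Theory.
Import numFieldNormedType.Exports.
Local Open Scope classical_set_scope.
Local Open Scope ring_scope.

Section borel_measures.
Variable R : realType.

Definition borel (X : ptopologicalType) := g_sigma_algebraType (@open X).

(* Two bundled measures may differ on non-measurable sets, so measures are
   never compared by Leibniz equality, only on measurable sets. *)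
Definition same_measure (X : ptopologicalType)
    (mu nu : probability (borel X) R) : Prop :=
  forall A : set (borel X), measurable A -> mu A = nu A.

Definition invariant_measure (X : ptopologicalType) (T : X -> X)
    (mu : probability (borel X) R) : Prop :=
  forall A : set (borel X), measurable A -> mu (T @^-1` A) = mu A.

Definition measure_support (X : ptopologicalType)
    (mu : probability (borel X) R) : set X :=
  [set x | forall U : set X, open U -> U x -> (0 < mu U)%E].

Definition pointed_at (X : topologicalType) (x0 : X) : ptopologicalType :=
  HB.pack_for ptopologicalType (X : Type) (isPointed.Build X x0)
    (Topological.class X).

(* The library only has measurable structures on pointed types. The witness
   [x0] only serves to provide one: the sigma-algebra and the measures do not
   depend on it, and an empty space has no probability measure. *)
Definition uniquely_ergodic (X : topologicalType) (T : X -> X) : Prop :=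
  exists x0 : X,
  exists nu : probability (borel (pointed_at x0)) R,
    invariant_measure (T : pointed_at x0 -> pointed_at x0) nu /\
    forall nu' : probability (borel (pointed_at x0)) R,
      invariant_measure (T : pointed_at x0 -> pointed_at x0) nu' ->
      same_measure nu' nu.

End borel_measures.

Definition Sigma2 : Type := {ptws int -> bool}.
HB.instance Definition _ := Pointed.on Sigma2.
HB.instance Definition _ := Nbhs.on Sigma2.
HB.instance Definition _ := Topological.on Sigma2.

Definition shift_map (x : Sigma2) : Sigma2 := fun i : int => x (i + 1).

Lemma shift_continuous : continuous shift_map.
Proof.
move=> x; apply/cvg_sup => i U [_ [[B oB <-] Bx] BU].
have : nbhs x (@proj int (fun=> bool) (i + 1) @^-1` B).
  by apply: proj_continuous; apply: open_nbhs_nbhs.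
by apply: filterS => y By; apply: BU.
Qed.

Section restriction.
Variables (R : realType) (mu : probability (borel Sigma2) R).
Hypothesis mu_inv : invariant_measure shift_map mu.

Lemma support_shift (x : Sigma2) :
  measure_support mu x -> measure_support mu (shift_map x).
Proof.
move=> sx U oU Ux; rewrite -mu_inv; last exact: sub_sigma_algebra.
apply: sx Ux.
by apply: open_comp => // y _; exact: shift_continuous.
Qed.

(* The restriction of the shift to the support of [mu], the latter carrying
   the subspace topology of [set_type]. *)
Definition support_map (x : measure_support mu) : measure_support mu :=
  SigSub (mem_set (support_shift (set_valP x))).

End restriction.

Section weighted_shifts.
Variables (R : realType) (H : completeNormedModType R).

Definition hilbert_product (ip : {dot H for idfun}) : Prop :=
  forall x : H, ip x x = `|x| ^+ 2.

Definition orthonormal_basis (ip : {dot H for idfun}) (e : int -> H) : Prop :=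
  (forall i j : int, ip (e i) (e j) = (i == j)%:R) /\
  dense [set x : H | exists (s : seq int) (c : int -> R),
                       x = \sum_(i <- s) c i *: e i].

(* By [linear_boundedP], this is [exists r, forall x, `|L x| <= r * `|x|]. *)
Definition bounded_operator (L : {linear H -> H}) : Prop :=
  bounded_near L (nbhs (0 : H)).

Definition invertible_operator (L : {linear H -> H}) : Prop :=
  exists M : {linear H -> H},
    [/\ bounded_operator M, cancel L M & cancel M L].

Definition positive_weighted_shift (e : int -> H) (L : {linear H -> H}) :
    Prop :=
  exists alpha : int -> R,
    (forall i, 0 < alpha i) /\ (forall i, L (e i) = alpha i *: e (i + 1)).

Definition opair : Type := ({linear H -> H} * {linear H -> H})%type.

Definition weighted_pairs (e : int -> H) : set opair :=
  [set p | [/\ bounded_operator p.1, invertible_operator p.1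
             & positive_weighted_shift e p.1] /\
           [/\ bounded_operator p.2, invertible_operator p.2
             & positive_weighted_shift e p.2]].

Definition opnorm (f : H -> H) : R :=
  sup [set `|f x| | x in [set x : H | `|x| <= 1]].

Definition open_in_weighted_pairs (e : int -> H) (U : set opair) : Prop :=
  U `<=` weighted_pairs e /\
  forall p : opair, U p ->
    exists2 r : R, 0 < r &
      forall q : opair, weighted_pairs e q ->
        opnorm (fun x => q.1 x - p.1 x) < r ->
        opnorm (fun x => q.2 x - p.2 x) < r -> U q.

Definition op_of (p : opair) (b : bool) : {linear H -> H} :=
  if b then p.2 else p.1.

(* [:: x_1; ...; x_n] is mapped to L_{x_n} \o ... \o L_{x_1}. *)
Definition op_prod (p : opair) (w : seq bool) : H -> H :=
  foldl (fun (f : H -> H) b => op_of p b \o f) id w.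

Definition joint_spectral_radius (p : opair) : R :=
  limn (fun n : nat =>
    sup [set opnorm (op_prod p w) `^ n%:R^-1 | w in [set: n.-tuple bool]]).

Definition prefix_word (x : Sigma2) (n : nat) : seq bool :=
  [seq x i%:Z | i <- iota 1 n].

Definition maximising (p : opair) (mu : probability (borel Sigma2) R) : Prop :=
  invariant_measure shift_map mu /\
  (fun n : nat =>
     n%:R^-1 * \int[mu]_x ln (opnorm (op_prod p (prefix_word x n)))) @ \oo
    --> ln (joint_spectral_radius p).

End weighted_shifts.

(* Main.v *)
Require Import Defs.
From HB Require Import structures.
From mathcomp Require Import finmap.
From mathcomp Require Import all_boot all_order all_algebra.
From mathcomp Require Import all_classical all_reals all_analysis.
From mathcomp Require Import lra zify.
Set Implicit Arguments.
Unset Strict Implicit.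
Unset Printing Implicit Defensive.
Import Order.TTheory GRing.Theory Num.Theory.
Import numFieldNormedType.Exports.
Local Open Scope classical_set_scope.
Local Open Scope ring_scope.

(** The letter of largest weight at site [i] is prescribed to be [z i],
    where [z] is a point of the support [Z] of [mu], and the other weight is
    smaller by a uniform gap. This condition is open. The norm of a product
    along a word [w] is the supremum over [i] of the product of the weights
    of the letters of [w] read from site [i], so the largest norm at length
    [n] is reached along the words of [z].

    By unique ergodicity every long window of [z] has nearly the letter
    statistics of [mu]; cutting a nearly optimal window of length [N] into
    subwindows of length [n << N] shows that the mean growth of [mu] at each
    length [n] is at least the limit growth, however the heavy weights vary
    along [z]. Hence [mu] is maximising.

    Conversely, each letter by which a word differs from the closest window
    of [z] costs a fixed factor. For a maximising [nu] the density of
    mismatches therefore tends to [0] in mean, so [nu] gives the same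
    frequencies as windows of [z], which are those of [mu].

    The uniform frequencies are obtained by contradiction: an ultrafilter
    limit of empirical frequencies is a finitely additive function of clopen
    sets, which is countably additive by compactness and extends to an
    invariant probability measure on [Z], different from the unique one. *)

(** * Extension of a content on clopen sets *)

(** A synonym of [X]: its measurable sets are the clopen ones, which form an algebra of sets, while
    [borel X] keeps the Borel structure. *)
Definition clopen_algebra (X : ptopologicalType) : Type := X.

HB.instance Definition _ (X : ptopologicalType) :=
  Pointed.on (clopen_algebra X).

HB.instance Definition _ (X : ptopologicalType) :=
  isAlgebraOfSets.Build default_measure_display (clopen_algebra X)
    (@clopen0 X) (@clopenU X) (fun A cA => @clopenC X A A cA).

Section clopen_extension.
Variables (R : realType) (X : ptopologicalType) (m : set X -> R).
Hypothesis X_compact : compact [set: X].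
Hypothesis clopen_gen : forall U : set X, open U -> <<s @clopen X >> U.
Hypothesis m_ge0 : forall A, 0 <= m A.
Hypothesis mT : m setT = 1.
Hypothesis mU : forall A B, clopen A -> clopen B -> A `&` B = set0 ->
  m (A `|` B) = m A + m B.

Let me (A : set (clopen_algebra X)) : \bar R := (m A)%:E.

Let m0 : m set0 = 0.
Proof.
have := mU (@clopen0 X) (@clopen0 X) (setI0 _).
by rewrite setU0 => /eqP; rewrite addrC -subr_eq subrr eq_sym => /eqP.
Qed.

Let m_bigU (F : nat -> set X) n : (forall i, clopen (F i)) -> trivIset setT F ->
  m (\big[setU/set0]_(i < n) F i) = \sum_(i < n) m (F i).
Proof.
move=> cF tF; elim: n => [|n IHn]; first by rewrite !big_ord0 m0.
have cS : clopen (\big[setU/set0]_(i < n) F i).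
  by apply: big_ind => [|A B|i _] //; [exact: clopen0|exact: clopenU].
rewrite !big_ord_recr /= mU ?IHn //.
by apply: (@trivIset_bigsetUI _ predT) => //; rewrite /predT /= trueE.
Qed.

Let clopen_measure0 : me set0 = 0%E. Proof. by rewrite /me m0. Qed.

Let clopen_measure_ge0 A : (0 <= me A)%E. Proof. by rewrite lee_fin. Qed.

(** A clopen countable union is closed, hence compact, and its members are open: finitely many of
    them cover it. The partial unions, and with them the partial sums, are therefore eventually
    constant. *)
Let clopen_measure_sigma_additive : semi_sigma_additive me.
Proof.
move=> F mF tF mUF.
have cK : compact (\bigcup_i F i : set X).
  by apply: (subclosed_compact _ X_compact) => //; exact: mUF.2.
move: cK; rewrite compact_cover => /(_ nat setT F).
case=> [i _|//|D _ UD]; first exact: (mF i).1.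
pose N := (\max_(i <- D) i).+1.
have DN i : i \in D -> (i < N)%N.
  by by move=> iD; rewrite ltnS; exact: (leq_bigmax_seq (F := id) _ iD).
have UN n : (N <= n)%N -> \bigcup_i F i = \big[setU/set0]_(i < n) F i.
  move=> Nn; rewrite -bigcup_mkord; apply/seteqP; split => x.
    move=> /UD[i iD Fi]; exists i => //=; apply: leq_trans Nn.
    exact: DN.
  by move=> [i _ Fi]; exists i.
apply: cvg_near_cst; exists N => // n /= Nn.
by rewrite /me (UN n Nn) m_bigU // sumEFin big_mkord.
Qed.

HB.instance Definition _ := isMeasure.Build _ _ _ me
  clopen_measure0 clopen_measure_ge0 clopen_measure_sigma_additive.

Let mext (A : set (borel X)) : \bar R :=
  measure_extension me A.

(** The Caratheodory extension is a measure on the sigma-algebra generated by the clopen sets; this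
    identifies that sigma-algebra with the Borel one. *)
Let open_clopen (A : set X) : <<s @open X >> A = <<s @clopen X >> A.
Proof.
rewrite propeqE; split; apply: smallest_sub A;
  try exact: smallest_sigma_algebra.
  exact: clopen_gen.
by move=> A [oA _]; apply: sub_sigma_algebra.
Qed.

Let mext0 : mext set0 = 0%E. Proof. exact: measure0. Qed.

Let mext_ge0 A : (0 <= mext A)%E. Proof. exact: measure_ge0. Qed.

Let mext_sigma_additive : semi_sigma_additive mext.
Proof.
move=> F mF tF mUF.
apply: (@measure_semi_sigma_additive _ _ _ (measure_extension me)) => //.
  by move=> i; have := mF i; rewrite /measurable /= open_clopen.
by move: mUF; rewrite /measurable /= open_clopen.
Qed.

HB.instance Definition _ := isMeasure.Build _ _ _ mext
  mext0 mext_ge0 mext_sigma_additive.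

Let mextE A : clopen A -> mext A = (m A)%:E.
Proof. by move=> cA; rewrite /mext /measure_extension measurable_mu_extE. Qed.

Let mextT : mext setT = 1%E.
Proof. by rewrite mextE ?mT //; exact: clopenT. Qed.

HB.instance Definition _ := Measure_isProbability.Build _ _ _ mext mextT.

Lemma clopen_extension : exists nu : probability (borel X) R,
  forall A : set X, clopen A -> nu A = (m A)%:E.
Proof. by exists mext. Qed.

End clopen_extension.

(** * Empirical measures *)

Definition birkhoff_avg (R : realType) (X : Type) (T : X -> X) (f : X -> R)
    (n : nat) (x : X) : R := n%:R^-1 * \sum_(j < n) f (iter j T x).

(** The image of [U] has a cluster point in the compact segment [[a, b]], and a cluster point of an
    ultrafilter is a limit of it. *)
Lemma ultrafilter_cvg (R : realType) (I : Type) (U : set_system I) (f : I -> R)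
    (a b : R) : UltraFilter U -> (forall i, a <= f i <= b) -> cvg (f @ U).
Proof.
move=> ultraU fab.
have UI : U (f @^-1` `[a, b]) by apply: filterE => i; rewrite /= in_itv /=.
have [p [_ clp]] := @segment_compact R a b (f @ U) _ UI.
apply/cvg_ex; exists p => A nA.
have [//|UnA] := in_ultra_setVsetC (f @^-1` A) ultraU.
by have [y []] := clp (~` A) A UnA nA.
Qed.

Lemma birkhoff_avg_itv (R : realType) (X : Type) (T : X -> X) (A : set X) n x :
  0 <= birkhoff_avg T (\1_A : X -> R) n x <= 1.
Proof.
have H : 0 <= \sum_(j < n) (\1_A (iter j T x) : R) <= n%:R.
  rewrite sumr_ge0 /= => [|j _]; last by rewrite indicE.
  rewrite -[leRHS]mul1r mulr_natr -[in leRHS](card_ord n) -sumr_const.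
  by apply: ler_sum => j _; rewrite indicE; case: (_ \in _).
rewrite /birkhoff_avg; case/andP: H => h0 h1.
rewrite mulr_ge0 ?invr_ge0 //=; case: n h0 h1 => [|n] h0 h1.
  by rewrite invr0 mul0r.
by rewrite mulrC ler_pdivrMr ?ltr0n // mul1r.
Qed.

Section empirical_limit.
Variables (R : realType) (X : ptopologicalType) (T : X -> X).
Hypothesis X_compact : compact [set: X].
Hypothesis clopen_gen : forall U : set X, open U -> <<s @clopen X >> U.
Hypothesis T_cont : continuous T.

(** The clopen sets are a generating pi-system, and on it [nu] agrees with its pushforward under
    [T]. *)
Lemma continuous_invariant (nu : probability (borel X) R) :
  (forall A, clopen A -> nu (T @^-1` A) = nu A) -> invariant_measure T nu.
Proof.
move=> nuT.
have mT : measurable_fun setT (T : borel X -> borel X).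
  apply: (@measurability _ _ (borel X) (borel X) setT T (@open X) erefl).
  move=> _ [A oA <-]; rewrite setTI.
  apply: sub_sigma_algebra; apply: open_comp => // y _; exact: T_cont.
move=> A mA.
have gA : <<s @clopen X >> A.
  by move: A mA; apply: smallest_sub; [exact: smallest_sigma_algebra|].
apply: (@g_sigma_algebra_measure_unique _ R (borel X) (@clopen X) _
  (fun=> setT) _ _ (pushforward nu (T : borel X -> borel X)) nu) => //.
- by move=> B [oB _]; exact: sub_sigma_algebra.
- by move=> _; exact: clopenT.
- by rewrite bigcup_const.
- exact: clopenI.
- by move=> k; rewrite -[ltLHS]/(nu [set: X]) probability_setT ltry.
Qed.

(** Along one ultrafilter finer than [\oo] the frequencies of all sets converge at once, and limits
    respect sums. The limits form a finitely additive function, which [clopen_extension] turns into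
    a measure. *)
Lemma empirical_limit (x : nat -> X) (N : nat -> nat) :
  (forall k, (k < N k)%N) ->
  exists nu : probability (borel X) R, invariant_measure T nu /\
    exists2 U : set_system nat, ProperFilter U & forall A : set X, clopen A ->
      birkhoff_avg T (\1_A) (N k) (x k) @[k --> U] --> fine (nu A).
Proof.
move=> Nk.
have [U [ultraU ooU]] := @ultraFilterLemma nat (nbhs \oo) _.
pose fr (A : set X) k : R := birkhoff_avg T \1_A (N k) (x k).
have fr_cvg A : cvg (fr A @ U).
  by apply: (@ultrafilter_cvg _ _ _ _ 0 1) => k; exact: birkhoff_avg_itv.
pose m A := lim (fr A @ U).
have [| | |nu nuE] := @clopen_extension R X m X_compact clopen_gen.
- move=> A; apply: limr_ge => //; apply: filterE => k.
  by have /andP[] := birkhoff_avg_itv R T A (N k) (x k).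
- apply/cvg_lim => //; apply: cvg_near_cst; apply: filterE => k.
  rewrite /fr /birkhoff_avg.
  under eq_bigr do rewrite indicT.
  rewrite sumr_const card_ord mulVf // pnatr_eq0.
  by have := Nk k; case: (N k).
- move=> A B _ _ AB0; apply/cvg_lim => //.
  rewrite [X in X @ U --> _](_ : _ = fr A \+ fr B); first exact: cvgD.
  apply/funext => k; rewrite /fr /birkhoff_avg /= -mulrDr -big_split /=.
  congr (_ * _); apply: eq_bigr => j _; rewrite !indicE in_setU.
  set y := iter _ _ _.
  have : ~~ ((y \in A) && (y \in B)).
    by rewrite -in_setI AB0 in_set0.
  by case: (y \in A); case: (y \in B) => //= _; rewrite ?addr0 ?add0r.
exists nu; split; last first.
  exists U; first exact: ultra_proper.
  by move=> A cA; rewrite nuE //; exact: fr_cvg.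
apply: continuous_invariant => A cA.
have cTA : clopen (T @^-1` A) by exact: preimage_clopen.
rewrite !nuE //; congr EFin.
apply/eqP; rewrite -subr_eq0 /m -limB //; apply/eqP/cvg_lim => //.
(* The frequencies of [A] and of its preimage differ by a telescoping sum, of absolute value at most
   [1], divided by [N k]. As [k < N k], this is at most [harmonic k], that is [1 / (k + 1)]. *)
have h : (harmonic : nat -> R) @ U --> 0.
  apply: cvg_trans (@cvg_harmonic R); exact: cvg_app.
apply: norm_cvg0.
apply: (@squeeze_cvgr _ _ _ _ (fun=> 0) harmonic) => //; last exact: cvg_cst.
apply: filterE => k; rewrite normr_ge0 /=.
rewrite -[(_ - _) k]/(fr (T @^-1` A) k - fr A k)
  /fr /birkhoff_avg -mulrBr -sumrB.
have -> : \sum_(i < N k) (\1_(T @^-1` A) (iter i T (x k))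
  - \1_A (iter i T (x k)))
    = \1_A (iter (N k) T (x k)) - \1_A (x k) :> R.
  rewrite -(big_mkord predT (fun i => \1_(T @^-1` A) (iter i T (x k)) -
    \1_A (iter i T (x k)) : R)).
  rewrite (eq_bigr (fun i => (fun j => \1_A (iter j T (x k)) : R) i.+1 -
    (fun j => \1_A (iter j T (x k)) : R) i)) ?telescope_sumr //.
rewrite normrM normfV normr_nat /=.
have n1 (a b : bool) : `|a%:R - b%:R| <= 1 :> R.
  by case: a; case: b; rewrite ?subrr ?subr0 ?sub0r ?normrN ?normr0 ?normr1.
have N0 : 0 < (N k)%:R :> R by rewrite ltr0n; apply: leq_ltn_trans (Nk k).
rewrite !indicE; apply: le_trans (_ : (N k)%:R^-1 <= _).
  by rewrite ler_piMr // invr_ge0 ltW.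
by rewrite lef_pV2 ?posrE ?ltr0Sn // ler_nat.
Qed.

End empirical_limit.

(** * The full shift *)

(** The list of constraints may repeat a site or contradict itself. Concatenating lists intersects
    cylinders, and [pickle] enumerates them. *)
Definition cylinder (l : seq (int * bool)) : set Sigma2 :=
  [set x | all (fun p => x p.1 == p.2) l].

(** The codomain is arbitrary: [T := Prop] covers sets of points, [T := R] covers observables. *)
Definition depends_on (s : seq int) (T : Type) (f : Sigma2 -> T) : Prop :=
  forall x y : Sigma2, (forall i, i \in s -> x i = y i) -> f x = f y.

(** The supersets of the cylinders around [x] form a filter. It converges to [x] in each coordinate,
    hence in the product topology, so it contains every neighbourhood of [x]. *)
Lemma nbhs_cylinder (x : Sigma2) (U : set Sigma2) :
  nbhs x U -> exists l, cylinder l x /\ cylinder l `<=` U.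
Proof.
pose F : set_system Sigma2 :=
  [set V | exists l, cylinder l x /\ cylinder l `<=` V].
have FF : Filter F.
  split.
  - by exists [::]; split.
  - move=> P Q [l [lx lP]] [k [kx kQ]]; exists (l ++ k); split.
      by rewrite /cylinder /= all_cat; apply/andP.
    by move=> y; rewrite /cylinder /= all_cat => /andP[ly ky]; split;
      [exact: lP|exact: kQ].
  - by move=> P Q PQ [l [lx lP]]; exists l; split=> // y /lP; exact: PQ.
suff : F --> x by apply.
apply/cvg_sup => i V [_ [[B oB <-] Bx] BV].
exists [:: (i, x i)]; split; first by rewrite /cylinder /= eqxx.
move=> y; rewrite /cylinder /= andbT => /eqP yx; apply: BV.
by rewrite /= yx.
Qed.

Lemma open_cylinder l : open (cylinder l).
Proof.
elim: l => [|[i b] l IHl].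
  by rewrite (_ : cylinder [::] = setT); [exact: openT|exact/seteqP].
rewrite (_ : cylinder _ = @proj int (fun=> bool)
  i @^-1` [set b] `&` cylinder l).
  apply: openI => //; apply: open_comp; last exact: discrete_open.
  by move=> x _; exact: proj_continuous.
apply/seteqP; split => x.
  by rewrite /cylinder /= => /andP[/eqP].
by move=> [xb lx]; apply/andP; split => //; exact/eqP.
Qed.

Lemma open_depends_on s (P : set Sigma2) : depends_on s P -> open P.
Proof.
move=> sP; rewrite openE => x Px.
apply: (@filterS _ _ _ (cylinder [seq (i, x i) | i <- s])).
  move=> y; rewrite /cylinder /= all_map => /allP yx.
  by rewrite (sP y x) // => i /yx /eqP.
apply: open_nbhs_nbhs; split; first exact: open_cylinder.
by rewrite /cylinder /= all_map; apply/allP => i _ /=.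
Qed.

Lemma clopen_depends_on s (P : set Sigma2) : depends_on s P -> clopen P.
Proof.
move=> sP; split; first exact: open_depends_on sP.
rewrite -[P]setCK; apply: open_closedC; apply: (@open_depends_on s) => x y xy.
by rewrite /setC /= (sP x y).
Qed.

Lemma depends_on_cylinder l :
  depends_on [seq p.1 | p <- l] (fun x => cylinder l x).
Proof.
move=> x y xy; rewrite /cylinder /=; congr is_true; apply: eq_in_all => p pl.
by rewrite (xy p.1) // map_f.
Qed.

(** There are countably many cylinders, so an open set is the countable union of the preimages of
    cylinders that it contains. The map [g] is later the inclusion of the support, or the
    identity. *)
Lemma cylinder_gen (X : topologicalType) (g : X -> Sigma2) (G : set (set X)) :
  (forall x U, nbhs x U -> exists2 V, nbhs (g x) V & g @^-1` V `<=` U) ->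
  (forall l, G (g @^-1` cylinder l)) ->
  forall U : set X, open U -> <<s G >> U.
Proof.
move=> gnbhs Gl U oU.
pose F n := if unpickle n is Some l then

  if `[< g @^-1` cylinder l `<=` U >] then g @^-1` cylinder l else set0 else
    set0.
rewrite (_ : U = \bigcup_n F n); last first.
  apply/seteqP; split => x.
    move=> Ux.
    have [V /nbhs_cylinder[l [lx lV]] VU] :=
      gnbhs x U (open_nbhs_nbhs (conj oU Ux)).
    have lU : g @^-1` cylinder l `<=` U by move=> y /= /lV; exact: VU.
    by exists (pickle l) => //; rewrite /F pickleK asboolT.
  move=> [n _]; rewrite /F; case: (unpickle n) => // l.
  by case: asboolP => // lU; exact: lU.
apply: sigma_algebra_bigcup.
move=> n; rewrite /F; case: (unpickle n) => [l|]; last exact: sigma_algebra0.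
case: asboolP => _; last exact: sigma_algebra0.
exact: sub_sigma_algebra.
Qed.

Lemma compact_Sigma2 : compact [set: Sigma2].
Proof.
have := @tychonoff int (fun=> bool) (fun=> setT) (fun=> bool_compact).
by congr (compact _); apply/seteqP.
Qed.

Lemma iter_shift_map n x (i : int) : iter n shift_map x i = x (i + n%:Z).
Proof.
elim: n x i => [|n IHn] x i; first by rewrite addr0.
by rewrite iterS /shift_map IHn intS addrA.
Qed.

(** * The support of a measure on the full shift *)

Section support.
Variables (R : realType) (mu : probability (borel Sigma2) R).

Lemma closed_support : closed (measure_support mu).
Proof.
move=> x clx U oU Ux.
have [y [sy Uy]] := clx U (open_nbhs_nbhs (conj oU Ux)).
exact: sy.
Qed.

(** Each point outside the support lies in a null cylinder, and there are countably many
    cylinders. *)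
Lemma supportC0 : mu (~` measure_support mu) = 0%E.
Proof.
pose F n : set (borel Sigma2) := if unpickle n is Some l then
  if mu (cylinder l) == 0%E then cylinder l else set0 else set0.
have mF n : measurable (F n).
  rewrite /F; case: (unpickle n) => // l; case: eqP => // _.
  by apply: sub_sigma_algebra; exact: open_cylinder.
have cF : ~` measure_support mu `<=` \bigcup_n F n.
  move=> x /existsNP[U /not_implyP[oU /not_implyP[Ux /negP]]].
  rewrite -leNgt => U0.
  have [l [lx lU]] := nbhs_cylinder (open_nbhs_nbhs (conj oU Ux)).
  exists (pickle l) => //; rewrite /F pickleK.
  rewrite (_ : mu _ == 0%E) // eq_le measure_ge0 andbT.
  apply: le_trans U0; apply: le_measure => //; rewrite inE;
    apply: sub_sigma_algebra => //.
  exact: open_cylinder.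
apply/eqP; rewrite eq_le measure_ge0 andbT.
have mC : measurable (~` measure_support mu : set (borel Sigma2)).
  by apply: sub_sigma_algebra; apply: closed_openC; exact: closed_support.
have H := @measure_sigma_subadditive _ _ _ mu (~` measure_support mu)
  F mF mC cF.
apply: le_trans H _.
rewrite eseries0 // => n _ _; rewrite /F; case: (unpickle n) => [l|].
  by case: eqP => // _; rewrite measure0.
by rewrite measure0.
Qed.

(** The type of points of the support, with its subspace topology, inherits compactness from the
    closed subset: a cluster point of the image filter lifts back. *)
Lemma compact_support : compact [set: measure_support mu].
Proof.
have cS : compact (measure_support mu).
  by apply: (subclosed_compact closed_support compact_Sigma2).
move=> F FF _.
pose v : measure_support mu -> Sigma2 := set_val.
have FS : (v @ F) (measure_support mu).
  apply: (@filterE _ F) => x; exact: set_valP.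
have [p [Sp clp]] := cS (v @ F) _ FS.
exists (SigSub (mem_set Sp)); split=> // A B FA [V [[W oW <-] /= Wp WB]].
have [_ [[y Ay <-] Wy]] : v @` A `&` W !=set0.
  apply: clp; last exact: open_nbhs_nbhs.
  by apply: (@filterS _ F _ A) => // y Ay; exists y.
by exists y; split => //; exact: WB.
Qed.

End support.

(** * Two-sided translations and functions of finitely many coordinates *)

Definition shiftz (k : int) (x : Sigma2) : Sigma2 := fun i : int => x (i + k).

Lemma iter_shift n x : iter n shift_map x = shiftz n x.
Proof. by apply/funext => i; rewrite iter_shift_map. Qed.

Lemma shiftz_continuous k : continuous (shiftz k).
Proof.
move=> x; apply/cvg_sup => i U [_ [[B oB <-] Bx] BU].
have : nbhs x (@proj int (fun=> bool) (i + k) @^-1` B).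
  by apply: proj_continuous; apply: open_nbhs_nbhs.
by apply: filterS => y By; apply: BU.
Qed.

Lemma open_shiftz k A : open A -> open (shiftz k @^-1` A).
Proof. by move=> oA; apply: open_comp => // x _; exact: shiftz_continuous. Qed.

Lemma shiftzK k x : shiftz k (shiftz (- k) x) = x.
Proof. by apply/funext => i; rewrite /shiftz addrK. Qed.

Lemma depends_on_shiftz k s T (f : Sigma2 -> T) : depends_on s f ->
  depends_on [seq i + k | i <- s] (f \o shiftz k).
Proof.
by move=> sf x y xy; apply: sf => i si; apply: xy;
  exact: (map_f (fun i => i + k)).
Qed.

(** Sites outside [s] receive the default letter [false], which a function depending on [s] alone
    does not see. Such a function thus takes finitely many values, one for each word on [s]. *)
Definition extend_word (s : seq int) (w : seq bool) : Sigma2 :=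
  fun i => nth false w (index i s).

Lemma depends_on_word s T (f : Sigma2 -> T) x : depends_on s f ->
  f x = f (extend_word s [seq x i | i <- s]).
Proof.
move=> sf; apply: sf => i si; rewrite /extend_word (nth_map i) ?index_mem //.
by rewrite nth_index.
Qed.

Lemma depends_on_birkhoff (R : realType) s (f : Sigma2 -> R)
  n : depends_on s f ->
  depends_on [seq i + j%:Z | i <- s, j <- iota 0 n] (birkhoff_avg shift_map f
    n).
Proof.
move=> sf x y xy; rewrite /birkhoff_avg; congr (_ * _); apply: eq_bigr => j _.
rewrite !iter_shift; apply: sf => i si; apply: xy.
by apply: (allpairs_f (fun i (j : nat) => i + j%:Z)) => //; rewrite mem_iota /=.
Qed.

Lemma depends_on_indic (R : realType) s (A : set Sigma2) : depends_on s A ->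
  depends_on s (\1_A : Sigma2 -> R).
Proof.
by move=> sA x y xy; rewrite !indicE; congr (nat_of_bool _)%:R;
  apply: asbool_equiv_eq; rewrite -(sA x y xy).
Qed.

(** * Integrals of functions of finitely many coordinates *)

Section integration.
Variables (R : realType) (nu : probability (borel Sigma2) R).

Lemma depends_on_measurable s (A : set (borel Sigma2)) :
  depends_on s (A : Sigma2 -> Prop) -> measurable A.
Proof. by move=> sA; apply: sub_sigma_algebra; exact: open_depends_on sA. Qed.

Lemma depends_on_integrable s (f : borel Sigma2 -> R) :
  depends_on s (f : Sigma2 -> R) -> nu.-integrable setT (EFin \o f).
Proof.
move=> sf; apply: measurable_bounded_integrable => //.
- by apply: le_lt_trans (probability_le1 nu measurableT) _; rewrite ltry.
- move=> _ B mB; rewrite setTI; apply: (@depends_on_measurable s) => x y xy.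
  by rewrite /preimage /= (sf x y).
(* A bound for [f]: each of its values is the value at one of the finitely many extended words,
   hence one term of this sum. *)
exists (\sum_(w : (size s).-tuple bool) `|f (extend_word s w)|).
split; first exact: num_real.
move=> M hM x _; apply: le_trans (ltW hM).
pose w := map_tuple x (in_tuple s).
rewrite (depends_on_word x sf) (bigD1 w) //= lerDl.
exact: sumr_ge0.
Qed.

Lemma Rintegral_sum (I : Type) (r : seq I) (F : I -> borel Sigma2 -> R) :
  (forall i, nu.-integrable setT (EFin \o F i)) ->
  nu.-integrable setT (EFin \o (fun x => \sum_(i <- r) F i x)) /\
  \int[nu]_x (\sum_(i <- r) F i x) = \sum_(i <- r) \int[nu]_x F i x.
Proof.
move=> iF; elim: r => [|i r [IHi IHr]].
  have -> : (fun x => \sum_(i <- [::]) F i x) = cst 0 :> (borel Sigma2 -> R).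
    by apply/funext => x; rewrite big_nil.
  rewrite big_nil /cst Rintegral_cst // mul0r; split=> //.
  exact: integrable0.
have -> : (fun x => \sum_(i <- i :: r) F i x) =
    (fun x => F i x + \sum_(i <- r) F i x) :> (borel Sigma2 -> R).
  by apply/funext => x; rewrite big_cons.
rewrite big_cons RintegralD // IHr; split=> //.
pose S := (fun x => \sum_(i <- r) F i x) : borel Sigma2 -> R.
rewrite -/S (_ : EFin \o _ = ((EFin \o F i) \+ (EFin \o S))%E) //.
exact: integrableD.
Qed.

Lemma Rintegral_indicator (A : set (borel Sigma2)) : measurable A ->
  \int[nu]_x (\1_A x : R) = fine (nu A).
Proof. by move=> mA; rewrite /Rintegral integral_indic // setIT. Qed.

Hypothesis nu_inv : invariant_measure shift_map nu.

(** A negative translation is undone by a positive one: the positive case, applied to the preimage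
    of [A], gives the negative case. *)
Lemma invariant_shiftz k (A : set Sigma2) : open A ->
  nu (shiftz k @^-1` A) = nu A.
Proof.
have pos (n : nat) B : open B -> nu (shiftz n @^-1` B) = nu B.
  elim: n B => [|n IHn] B oB.
    by congr (nu _); apply/seteqP; split=> x; rewrite /= -iter_shift.
  have -> : shiftz n.+1 @^-1` B = shiftz n @^-1` (shift_map @^-1` B).
    by apply/seteqP; split=> x; rewrite /= -!iter_shift.
  rewrite IHn; last exact: (@open_shiftz 1).
  by rewrite nu_inv //; exact: sub_sigma_algebra.
move=> oA; case: k => n; first exact: pos.
have oV : open (shiftz (Negz n) @^-1` A) by exact: open_shiftz.
rewrite -(pos n.+1) //; congr (nu _).
by apply/seteqP; split=> x /=; rewrite -{1}[n.+1%:Z]opprK shiftzK.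
Qed.

Lemma Rintegral_birkhoff_indic s (A : set (borel Sigma2)) n :
  depends_on s (A : Sigma2 -> Prop) -> (0 < n)%N ->
  \int[nu]_x (birkhoff_avg shift_map (\1_A : Sigma2 -> R) n x) = fine (nu A).
Proof.
move=> sA n0; rewrite /birkhoff_avg.
have sAj (j : 'I_n) := @depends_on_shiftz j%:Z _ _ _ (depends_on_indic R sA).
have eqA : (fun x => \sum_(j < n) \1_A (iter j shift_map x)) =
  (fun x => \sum_(j < n) (\1_A \o shiftz j) x) :> (borel Sigma2 -> R).
  by apply/funext => x; apply: eq_bigr => j _; rewrite iter_shift.
have [iS eS] := Rintegral_sum (index_enum 'I_n) (fun j =>
  depends_on_integrable (sAj j)).
rewrite RintegralZl //; last by rewrite eqA.
rewrite eqA eS (eq_bigr (fun=> fine (nu A))) => [|j _].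
  by rewrite sumr_const card_ord -[X in _ * X]mulr_natl mulKf // pnatr_eq0
    -lt0n.
rewrite -(invariant_shiftz j); last exact: open_depends_on sA.
rewrite -Rintegral_indicator //.
exact: depends_on_measurable (@depends_on_shiftz j%:Z _ _ _ sA).
Qed.

End integration.

(** * Uniform convergence of averages on the support *)

Section uniform_convergence.
Variables (R : realType) (mu : probability (borel Sigma2) R).
Hypothesis mu_inv : invariant_measure shift_map mu.
Let Z := measure_support mu.

(** Translations to the left are included, unlike in [support_shift], because windows of a point of
    the support may start at any integer. *)
Lemma support_shiftz k (x : Sigma2) : Z x -> Z (shiftz k x).
Proof.
move=> Zx U oU Ukx; rewrite -(invariant_shiftz mu_inv k) //.
exact: Zx (@open_shiftz k _ oU) Ukx.
Qed.

Hypothesis supp_ue : uniquely_ergodic R (support_map mu_inv).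

Lemma support_nonempty : exists x, Z x.
Proof. by have [x0 _] := supp_ue; exists (set_val x0); exact: set_valP. Qed.

(** The constant is the mass that the unique invariant measure of the support gives to [A]. If
    uniformity failed, ever longer orbit segments would have frequencies at distance more than [d]
    from it, and [empirical_limit] would produce an invariant measure with a different mass. *)
Let uniform_frequency_exists s (A : set Sigma2) : depends_on s A ->
  exists a : R, forall d : R, 0 < d -> exists N0, forall n y,
    (N0 <= n)%N -> Z y -> `|birkhoff_avg shift_map \1_A n y - a| <= d.
Proof.
move=> sA; have [x0 [nu0 [nu0_inv nu0_unique]]] := supp_ue.
pose X := pointed_at x0.
pose v : X -> Sigma2 := set_val.
pose T : X -> X := support_map mu_inv.
have v_cont : continuous v by exact: initial_continuous.
have T_cont : continuous T.
  move=> x U [_ [[W oW <-] /= Wx WU]].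
  have oW' : open (shift_map @^-1` W) by apply: (@open_shiftz 1).
  have : nbhs x (v @^-1` (shift_map @^-1` W)).
    by apply: v_cont; apply: open_nbhs_nbhs.
  by apply: filterS => y Wy; exact: WU.
have X_gen (U : set X) : open U -> <<s @clopen X >> U.
  apply: (@cylinder_gen X v) => [x V [_ [[W oW <-] /= Wx WV]]|l].
    by exists W => //; exact: open_nbhs_nbhs.
  apply: preimage_clopen v_cont;
    exact: clopen_depends_on (@depends_on_cylinder l).
have cA : clopen (v @^-1` A).
  by apply: preimage_clopen v_cont; exact: clopen_depends_on sA.
have avgE n (y : X) : birkhoff_avg T (\1_(v @^-1` A) : X -> R) n y =
    birkhoff_avg shift_map \1_A n (v y).
  rewrite /birkhoff_avg; congr (_ * _); apply: eq_bigr => j _.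
  rewrite !indicE; congr (nat_of_bool _)%:R.
  have -> : iter j shift_map (v y) = v (iter j T y) by elim: (nat_of_ord j) =>
    //= k ->.
  by apply/idP/idP; rewrite !inE.
exists (fine (nu0 (v @^-1` A))) => d d0; apply: contrapT => nuni.
have bad k : exists ny : nat * X, (k < ny.1)%N /\
    d < `|birkhoff_avg T \1_(v @^-1` A) ny.1 ny.2 - fine (nu0 (v @^-1` A))|.
  apply: contrapT => nbad; apply: nuni; exists k.+1 => n y kn Zy.
  rewrite leNgt; apply/negP => dn; apply: nbad.
  by exists (n, SigSub (mem_set Zy)); split => //; rewrite avgE.
have [ny nyP] := choice bad.
have X_compact : compact [set: X] := compact_support (mu := mu).
have [nu [nu_inv [U FU nuU]]] := @empirical_limit R X T X_compact
  X_gen T_cont (fun k => (ny k).2) (fun k => (ny k).1) (fun k => (nyP k).1).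
have mA : measurable (v @^-1` A : set (borel X)) by apply: sub_sigma_algebra;
  exact: cA.1.
have := nuU _ cA; rewrite (nu0_unique _ nu_inv _ mA).
move=> /cvgrPdist_lt /(_ d d0) Ud.
have [k] := filter_ex Ud.
by rewrite distrC ltNge (ltW (nyP k).2).
Qed.

(** The set [E] where the bound fails misses [Z], so it is null. There [|f - a|] is at most a
    constant [K], since [f] takes finitely many values, and [d + K * \1_E] has integral [d]. *)
Lemma Rintegral_approx s (f : borel Sigma2 -> R) (a d : R) :
  depends_on s (f : Sigma2 -> R) -> (forall x, Z x -> `|f x - a| <= d) ->
  `|\int[mu]_x f x - a| <= d.
Proof.
move=> sf fa.
pose E : set Sigma2 := [set x | ~ `|f x - a| <= d].
have sE : depends_on s E by move=> x y xy; rewrite /E /= (sf x y xy).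
have mE : measurable (E : set (borel Sigma2))
  by exact: depends_on_measurable sE.
have muE : mu E = 0%E.
  apply/eqP; rewrite eq_le measure_ge0 andbT -(supportC0 mu).
  apply: le_measure; rewrite ?inE //.
    by apply: sub_sigma_algebra; apply: closed_openC; exact: closed_support.
  by move=> x Ex Zx; exact/Ex/fa.
have sfa : depends_on s (fun x => f x - a) by move=> x y xy; rewrite (sf x y).
have snfa : depends_on s (fun x => `|f x - a|) by move=> x y xy;
  rewrite (sf x y).
pose K := \sum_(w : (size s).-tuple bool) `|f (extend_word s w) - a|.
have K_ub x : `|f x - a| <= K.
  pose w := map_tuple x (in_tuple s).
  rewrite (depends_on_word x snfa) /K (bigD1 w) //= lerDl.
  exact: sumr_ge0.
have sE1 : depends_on s (fun x => K * \1_E x : R).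
  by move=> x y xy; rewrite (depends_on_indic R sE xy).
have sE2 : depends_on s (fun x => d + K * \1_E x : R).
  by move=> x y xy; rewrite (depends_on_indic R sE xy).
have mu1 : fine (mu setT) = 1 by rewrite (_ : mu setT = 1%E) //;
  exact: probability_setT.
have -> : \int[mu]_x f x - a = \int[mu]_x (f x - a).
  rewrite RintegralB //; first by rewrite Rintegral_cst // mu1 mulr1.
  - exact: depends_on_integrable sf.
  - exact: (@depends_on_integrable _ _ [::] (cst a)).
apply: le_trans (le_normr_Rintegral _ _) _ => //;
  first exact: depends_on_integrable sfa.
apply: (@le_trans _ _ (\int[mu]_x (d + K * \1_E x))).
  apply: le_Rintegral => //.
  - exact: depends_on_integrable snfa.
  - exact: depends_on_integrable sE2.
  - move=> x _; rewrite indicE; case: (boolP (x \in E)) => [xE|].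
      rewrite mulr1; apply: le_trans (K_ub x) _; rewrite lerDr.
      (* The sign of [d] is read off at a point of [Z]. *)
      have [y Zy] := support_nonempty.
      exact: le_trans (normr_ge0 _) (fa y Zy).
    by rewrite notin_setE => /contrapT; rewrite mulr0 addr0.
rewrite RintegralD //; first last.
- exact: depends_on_integrable sE1.
- exact: (@depends_on_integrable _ _ [::] (cst d)).
rewrite Rintegral_cst // mu1 mulr1 RintegralZl //; last first.
  exact: depends_on_integrable (depends_on_indic R sE).
by rewrite Rintegral_indicator // muE mulr0 addr0.
Qed.

(** The limit frequency is [mu A]: by invariance every Birkhoff average of the indicator has
    integral [mu A], and for long times that average is uniformly close to the limit on [Z]. *)
Lemma uniform_frequency s (A : set Sigma2) : depends_on s A ->
  forall d : R, 0 < d -> exists N0, forall n y,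
    (N0 <= n)%N -> Z y -> `|birkhoff_avg shift_map \1_A n y - fine (mu A)| <= d.
Proof.
move=> sA; have [a aP] := uniform_frequency_exists sA.
have -> // : fine (mu A) = a.
apply/eqP; rewrite -subr_eq0 -normr_le0; apply/ler_addgt0Pr => d d0;
  rewrite add0r.
have [N0 N0P] := aP d d0.
rewrite -(Rintegral_birkhoff_indic mu_inv sA (ltn0Sn N0)).
have sB := @depends_on_birkhoff R s \1_A N0.+1 (depends_on_indic R sA).
by apply: (Rintegral_approx sB) => x Zx; apply: N0P => //; exact: leqnSn.
Qed.

(** [f] is a finite linear combination of the indicators of the sets [C w] on which the word read
    along [s] is fixed. *)
Lemma uniform_average s (f : Sigma2 -> R) : depends_on s f ->
  forall d : R, 0 < d -> exists N0, forall n y,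
    (N0 <= n)%N -> Z y -> `|birkhoff_avg shift_map f n y - \int[mu]_x f x| <= d.
Proof.
move=> sf.
pose C (w : (size s).-tuple bool) : set Sigma2 :=
  [set x | [seq x i | i <- s] = w].
have sC w : depends_on s (C w).
  move=> x y xy; rewrite /C /=.
  by have /eq_in_map -> : {in s, (x : int -> bool) =1 y} by move=> i; exact: xy.
pose F (w : (size s).-tuple bool) (x : Sigma2) : R :=
  f (extend_word s w) * \1_(C w) x.
have fE x : f x = \sum_w F w x.
  pose w := map_tuple x (in_tuple s).
  rewrite (bigD1 w) //= big1 => [|w' w'w].
    by rewrite addr0 (depends_on_word x sf) /F indicE mem_set // mulr1.
  rewrite /F indicE memNset ?mulr0 // /C /= => xw'.
  by move/eqP: w'w; apply; exact/val_inj.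
have iF w : mu.-integrable setT (EFin \o (F w : borel Sigma2 -> R)).
  apply: (@depends_on_integrable _ _ s) => x y xy.
  by rewrite /F (depends_on_indic R (sC w) xy).
have intf : \int[mu]_x f x = \sum_(w : (size s).-tuple bool)
  f (extend_word s w) * fine (mu (C w)).
  rewrite (_ : \int[mu]_x f x = \int[mu]_x (\sum_w F w x)); last first.
    by apply: eq_Rintegral => x _; rewrite fE.
  rewrite (Rintegral_sum _ iF).2; apply: eq_bigr => w _.
  rewrite RintegralZl ?Rintegral_indicator //;
    first exact: depends_on_measurable (sC w).
  exact: depends_on_integrable (depends_on_indic R (sC w)).
have avgf n y : birkhoff_avg shift_map f n y =
    \sum_(w : (size s).-tuple bool) f (extend_word s w)
      * birkhoff_avg shift_map \1_(C w) n y.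
  rewrite /birkhoff_avg (eq_bigr _ (fun j _ => fE _)) exchange_big /= mulr_sumr.
  apply: eq_bigr => w _; rewrite mulrCA; congr (_ * _).
  by rewrite mulr_sumr.
move=> d d0.
(* The sum of the absolute values of the coefficients, increased by [1] to be a positive divisor. *)
pose K := 1 + \sum_(w : (size s).-tuple bool) `|f (extend_word s w)|.
have K0 : 0 < K by rewrite ltr_pwDl // sumr_ge0.
have dK : 0 < d / K by exact: divr_gt0.
have [N0 N0P] := choice (fun w => uniform_frequency (sC w) dK).
exists (\max_w N0 w) => n y Nn Zy.
rewrite intf avgf -sumrB; apply: le_trans (ler_norm_sum _ _ _) _.
apply: (@le_trans _ _ (\sum_(w : (size s).-tuple bool)
  `|f (extend_word s w)| * (d / K))).
  apply: ler_sum => w _; rewrite -mulrBr normrM ler_wpM2l // N0P //.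
  by apply: leq_trans Nn; exact: leq_bigmax.
rewrite -mulr_suml mulrC -mulrA ger_pMr // mulrC ler_pdivrMr // mul1r /K.
by rewrite lerDr.
Qed.

End uniform_convergence.

(** * Orthonormal families and diagonal operators *)

Section hilbert.
Variables (R : realType) (H : completeNormedModType R) (ip : {dot H for idfun}).
Hypothesis ip_norm : hilbert_product ip.

Lemma ipC x y : ip x y = ip y x.
Proof. by rewrite (@hermitian_subproof _ _ _ _ ip x y) /= expr0 mul1r. Qed.

Lemma ipDl x y z : ip (x + y) z = ip x z + ip y z.
Proof. exact: linearDl. Qed.

Lemma ipZl a x z : ip (a *: x) z = a * ip x z.
Proof. exact: linearZl_LR. Qed.

Lemma ipDr x y z : ip z (x + y) = ip z x + ip z y.
Proof. by rewrite ipC ipDl !(ipC z). Qed.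

Lemma ipZr a x z : ip z (a *: x) = a * ip z x.
Proof. by rewrite ipC ipZl (ipC z). Qed.

Lemma ip0r z : ip z 0 = 0.
Proof. by rewrite -(scale0r 0) ipZr mul0r. Qed.

Section orthonormal_family.
Variables (I : eqType) (h : I -> H).
Hypothesis h_on : forall i j, ip (h i) (h j) = (i == j)%:R.

Lemma orthonormal_norm i : `|h i| = 1.
Proof.
apply/eqP; rewrite -(@eqrXn2 _ 2) // expr1n -ip_norm h_on eqxx //.
Qed.

Lemma ip_orthonormal_sum s (c : I -> R) i : uniq s ->
  ip (h i) (\sum_(j <- s) c j *: h j) = if i \in s then c i else 0.
Proof.
elim: s => [|j s IHs] /=; first by rewrite big_nil ip0r.
move=> /andP[js us]; rewrite big_cons ipDr ipZr h_on IHs // inE.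
case: eqVneq => [->|_] /=; first by rewrite (negbTE js) mulr1 addr0.
by rewrite mulr0 add0r.
Qed.

Lemma pythagoras s (c : I -> R) : uniq s ->
  `|\sum_(i <- s) c i *: h i| ^+ 2 = \sum_(i <- s) c i ^+ 2.
Proof.
elim: s => [|i s IHs] /=; first by rewrite !big_nil normr0 expr0n.
move=> /andP[iNs us]; rewrite !big_cons -ip_norm ipDl !ipDr !ipZl !ipZr h_on.
rewrite eqxx mulr1 [ip _ (h i)]ipC ip_orthonormal_sum // (negbTE iNs).
by rewrite !mulr0 addr0 add0r ip_norm IHs // expr2.
Qed.

(** Expand [|x - P|^2 >= 0], where [P] is the orthogonal projection of [x] on the span of the
    family. *)
Lemma bessel s x : uniq s -> \sum_(i <- s) ip (h i) x ^+ 2 <= `|x| ^+ 2.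
Proof.
move=> us; set S := \sum_(i <- s) _.
pose P := \sum_(i <- s) ip (h i) x *: h i.
have PP : ip P P = S by rewrite ip_norm pythagoras.
have ipPx z : ip P z = \sum_(i <- s) ip (h i) x * ip (h i) z.
  rewrite /P; elim: (s) => [|i t IHt]; first by rewrite !big_nil ipC ip0r.
  by rewrite !big_cons ipDl ipZl IHt.
have Px : ip P x = S by rewrite ipPx; apply: eq_bigr => i _; rewrite expr2.
have : 0 <= `|x + (-1) *: P| ^+ 2 by rewrite exprn_ge0.
rewrite -ip_norm ipDl !ipDr !ipZl !ipZr ip_norm PP [ip x P]ipC Px.
by rewrite !mulN1r opprK addNr addr0 subr_ge0.
Qed.

End orthonormal_family.

(** [L x] is the sum of the series [a n * ip (g n) x *: h n]. Pythagoras and Bessel bound its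
    segments by those of a convergent series, so completeness gives the sum. *)
Lemma diagonal_operator (g h : nat -> H) (a : nat -> R) (C : R) :
  (forall i j, ip (g i) (g j) = (i == j)%:R) ->
  (forall i j, ip (h i) (h j) = (i == j)%:R) ->
  (forall n, `|a n| <= C) ->
  exists L : {linear H -> H},
    (forall x, `|L x| <= C * `|x|) /\ (forall n, L (g n) = a n *: h n).
Proof.
move=> g_on h_on aC.
have C0 : 0 <= C by apply: le_trans (aC 0%N).
pose u x n := (a n * ip (g n) x) *: h n.
have uE x m n : `|\sum_(m <= k < n) u x k| ^+ 2 <=
    C ^+ 2 * \sum_(m <= k < n) ip (g k) x ^+ 2.
  rewrite (pythagoras h_on) ?iota_uniq // mulr_sumr; apply: ler_sum => k _.
  rewrite exprMn ler_wpM2r ?sqr_ge0 // -real_normK ?num_real //.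
  by rewrite lerXn2r ?nnegrE.
have u_cvg x : cvgn (series (u x)).
  apply/cauchy_cvgP/cauchy_seriesP => eps eps0.
  pose q n : R := ip (g n) x ^+ 2.
  have : cvgn (series q).
    apply: nondecreasing_is_cvgn.
      by apply: nondecreasing_series => n _ _; exact: sqr_ge0.
    exists (`|x| ^+ 2) => _ [n _ <-].
    by apply: (bessel g_on); exact: iota_uniq.
  move=> /cauchy_cvgP/cauchy_seriesP.
  (* Chosen so that [(C + 1)^2 * d = eps^2]; dividing by [C + 1] avoids the case [C = 0]. *)
  pose d := (eps / (C + 1)) ^+ 2.
  have C1 : 0 < C + 1 by rewrite ltr_wpDl.
  have d0 : 0 < d by rewrite exprn_gt0 // divr_gt0.
  move=> /(_ d d0); apply: filterS => -[m n] /= qd.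
  rewrite -(@ltr_pXn2r _ 2) ?nnegrE ?normr_ge0 ?(ltW eps0) //.
  apply: le_lt_trans (uE x m n) _.
  have Q0 : 0 <= \sum_(m <= k < n) ip (g k) x ^+ 2.
    by apply: sumr_ge0 => k _; exact: sqr_ge0.
  rewrite ger0_norm // in qd.
  apply: (@le_lt_trans _ _ ((C + 1) ^+ 2 * \sum_(m <= k < n) ip (g k) x ^+ 2)).
    by rewrite ler_wpM2r // lerXn2r ?nnegrE ?(ltW C1) // lerDl.
  rewrite mulrC -ltr_pdivlMr ?exprn_gt0 //.
  by apply: lt_le_trans qd _; rewrite /d expr_div_n.
pose L x : H := limn (series (u x)).
have L_lin : linear L.
  move=> k x y; apply/cvg_lim => //.
  have -> : series (u (k *: x + y)) = (k *: series (u x)) + series (u y).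
    apply/funext => n; rewrite /series /= -[RHS]/(k *: _ + _).
    rewrite scaler_sumr -big_split /=; apply: eq_bigr => i _.
    by rewrite /u ipDr ipZr mulrDr scalerDl scalerA mulrCA.
  by apply: cvgD; [apply: cvgZr; exact: u_cvg|exact: u_cvg].
pose LL : {linear H -> H} :=
  HB.pack L (GRing.isLinear.Build R H H *:%R L L_lin).
exists LL; split=> [x|n].
  have -> : `|LL x| = limn (fun n => `|series (u x) n|).
    by rewrite lim_norm //; exact: u_cvg.
  apply: limr_le; first by apply: is_cvg_norm; exact: u_cvg.
  apply: nearW => n.
  rewrite -(@ler_pXn2r _ 2) ?nnegrE ?mulr_ge0 //.
  apply: le_trans (uE x 0%N n) _; rewrite exprMn ler_wpM2l ?sqr_ge0 //.
  by apply: (bessel g_on); exact: iota_uniq.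
apply/cvg_lim => //; apply: cvg_near_cst; exists n.+1 => // N /= nN.
rewrite /series /= (bigD1_seq n) ?iota_uniq ?mem_index_iota //= big1 => [|i ni].
  by rewrite addr0 /u g_on eqxx mulr1.
by rewrite /u g_on (negbTE ni) mulr0 scale0r.
Qed.

End hilbert.

(** * Weighted shift operators *)

(** Even numbers enumerate the non-negative integers and odd ones the negative integers; this
    reindexes the basis for [diagonal_operator], whose series run over [nat]. *)
Definition int_enum (n : nat) : int :=
  if odd n then Negz n./2 else Posz n./2.

Definition int_index (i : int) : nat :=
  match i with Posz n => n.*2 | Negz n => n.*2.+1 end.

Lemma int_enumK : cancel int_enum int_index.
Proof.
move=> n; rewrite /int_enum -[RHS]odd_double_half.
by case: (odd n); rewrite /int_index ?add1n ?add0n.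
Qed.

Lemma int_indexK : cancel int_index int_enum.
Proof.
by case=> n; rewrite /int_enum /int_index /= odd_double ?uphalf_double
  ?half_double.
Qed.

Section shift_operators.
Variables (R : realType) (H : completeNormedModType R) (ip : {dot H for idfun}).
Variable e : int -> H.
Hypothesis ip_norm : hilbert_product ip.
Hypothesis e_basis : orthonormal_basis ip e.

Let e_on i j : ip (e i) (e j) = (i == j)%:R. Proof. exact: e_basis.1. Qed.

Lemma basis_norm i : `|e i| = 1.
Proof. exact: (orthonormal_norm ip_norm e_on). Qed.

Lemma bounded_operatorP (L : {linear H -> H}) :
  bounded_operator L <-> exists K, forall x, `|L x| <= K * `|x|.
Proof.
split=> [/linear_boundedP[K [_ LK]]|[K LK]].
  by exists (K + 1); apply: LK; rewrite ltrDl.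
apply/linear_boundedP; exists K; split; first exact: num_real.
by move=> M /ltW KM x; apply: le_trans (LK x) _; rewrite ler_wpM2r.
Qed.

(** Collects repeated indices with their multiplicities, since [pythagoras] asks for distinct
    ones. *)
Lemma span_uniq s (c : int -> R) : exists d,
  \sum_(i <- s) c i *: e i = \sum_(i <- undup s) d i *: e i.
Proof.
exists (fun i => c i *+ count_mem i s).
rewrite -big_undup_iterop_count; apply: eq_bigr => i _.
by rewrite -scalerMnl.
Qed.

(** On finite combinations of the basis the bound is Pythagoras; density extends it to all of [H],
    the a priori bound [K] of [L] controlling the error. *)
Lemma diagonal_shift_bound (L : {linear H -> H}) (c : int -> R) k C :
  bounded_operator L -> (forall i, L (e i) = c i *: e (i + k)) ->
  (forall i, `|c i| <= C) -> forall x, `|L x| <= C * `|x|.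
Proof.
move=> /bounded_operatorP[K LK] Le cC x.
have C0 : 0 <= C by apply: le_trans (cC 0).
have ek_on i j : ip (e (i + k)) (e (j + k)) = (i == j)%:R.
  by rewrite e_on (inj_eq (addIr k)).
have span s d : `|L (\sum_(i <- s) d i *: e i)| <= C * `|\sum_(i <- s)
  d i *: e i|.
  have [d' ->] := span_uniq s d.
  rewrite -(@ler_pXn2r _ 2) ?nnegrE ?mulr_ge0 ?normr_ge0 // exprMn.
  rewrite linear_sum /= (eq_bigr (fun i => (d' i * c i) *: e (i + k))).
    rewrite (pythagoras ip_norm e_on) ?undup_uniq //.
    rewrite (pythagoras ip_norm ek_on) ?undup_uniq //.
    rewrite mulr_sumr; apply: ler_sum => i _.
    rewrite exprMn mulrC ler_wpM2r ?sqr_ge0 // -real_normK ?num_real //.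
    by rewrite lerXn2r ?nnegrE.
  by move=> i _; rewrite linearZ /= Le scalerA.
apply/ler_addgt0Pr => eps eps0.
(* Replacing [x] by [y] costs at most [(|K| + C) * |x - y|]; the summand [1] makes [M] positive. *)
pose M := 1 + `|K| + C.
have M0 : 0 < M by rewrite /M -addrA ltr_pwDl // addr_ge0.
have [y [xy [s [d yE]]]] : ball x (eps / M) `&` [set y | exists (s : seq int)
    (c : int -> R), y = \sum_(i <- s) c i *: e i] !=set0.
  apply: e_basis.2; first by exists x; apply: ballxx; exact: divr_gt0.
  exact: ball_open.
have {}xy : `|x - y| < eps / M by move: xy; rewrite -ball_normE.
have -> : x = (x - y) + y by rewrite subrK.
rewrite {1}linearD; apply: le_trans (ler_normD _ _) _.
apply: (@le_trans _ _ (`|K| * `|x - y| + C * `|y|)).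
  apply: lerD; last by rewrite yE span.
  by apply: le_trans (LK _) _; rewrite ler_wpM2r // ler_norm.
rewrite subrK.
have : C * `|y| <= C * (`|x| + `|x - y|).
  rewrite ler_wpM2l //; have -> : `|y| = `|x - (x - y)| by rewrite subKr.
  exact: ler_normB.
have : M * `|x - y| <= eps by rewrite mulrC -ler_pdivlMr // ltW.
rewrite /M !mulrDl mulrDr mul1r; have := normr_ge0 (x - y); lra.
Qed.

(** The difference is a diagonal operator with zero coefficients, so [diagonal_shift_bound] applies
    to it with [C = 0]. *)
Lemma shift_operator_eq (L M : {linear H -> H}) :
  bounded_operator L -> bounded_operator M ->
  (forall i, L (e i) = M (e i)) -> L =1 M.
Proof.
move=> /bounded_operatorP[K LK] /bounded_operatorP[K' MK] LM x.
pose D : {linear H -> H} := (L \- M).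
have DE y : D y = L y - M y by [].
have /diagonal_shift_bound : bounded_operator D.
  apply/bounded_operatorP; exists (K + K') => y.
  by rewrite DE mulrDl; apply: le_trans (ler_normB _ _) _; exact: lerD.
move=> /(_ (fun=> 0) 0 0) D0; apply/eqP; rewrite -subr_eq0 -normr_le0 -DE.
rewrite -(mul0r `|x|); apply: D0 => i; last by rewrite normr0.
by rewrite DE LM subrr scale0r.
Qed.

Lemma diagonal_shift_exists (c : int -> R) k C : (forall i, `|c i| <= C) ->
  exists L : {linear H -> H},
    bounded_operator L /\ forall i, L (e i) = c i *: e (i + k).
Proof.
move=> cC.
have f_inj := can_inj int_enumK.
have [|||L [LC Le]] := @diagonal_operator R H ip ip_norm (e \o int_enum)
  (fun n => e (int_enum n + k)) (c \o int_enum) C.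
- by move=> i j; rewrite /= e_on (inj_eq f_inj).
- by move=> i j; rewrite /= e_on (inj_eq (addIr k)) (inj_eq f_inj).
- by move=> n; exact: cC.
exists L; split; first by apply/bounded_operatorP; exists C.
by move=> i; have := Le (int_index i); rewrite /= int_indexK.
Qed.

(** The inverse is the backward shift with coefficient [1 / a (i - 1)] at [e i]; both composites are
    the identity because they fix the basis. *)
Lemma weighted_shift_exists (a : int -> R) C c0 :
  0 < c0 -> (forall i, c0 <= a i <= C) ->
  exists L : {linear H -> H}, [/\ bounded_operator L, invertible_operator L &
    forall i, L (e i) = a i *: e (i + 1)].
Proof.
move=> c00 aC.
have a_gt0 i : 0 < a i by case/andP: (aC i) => h _; exact: lt_le_trans h.
have [|L [Lb Le]] := @diagonal_shift_exists a 1 C.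
  by move=> i; rewrite gtr0_norm //; case/andP: (aC i).
have [|M [Mb Me]] := @diagonal_shift_exists (fun i =>
  (a (i - 1))^-1) (- 1) c0^-1.
  move=> i; rewrite normfV gtr0_norm // lef_pV2 ?posrE //.
  by case/andP: (aC (i - 1)).
have comp_bounded (P Q : {linear H -> H}) : bounded_operator P ->
    bounded_operator Q -> bounded_operator (P \o Q).
  move=> /bounded_operatorP[K PK] /bounded_operatorP[K' QK].
  apply/bounded_operatorP; exists (`|K| * K') => x /=.
  apply: le_trans (PK _) _; apply: (@le_trans _ _ (`|K| * `|Q x|)).
    by rewrite ler_wpM2r // ler_norm.
  by rewrite -mulrA ler_wpM2l.
have idb : bounded_operator (idfun : {linear H -> H}).
  by apply/bounded_operatorP; exists 1 => x; rewrite mul1r.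
exists L; split=> //; exists M; split=> // x.
- apply: (@shift_operator_eq (M \o L) idfun) => // [|i];
  first exact: comp_bounded.
  by rewrite /= Le linearZ /= Me addrK scalerA divff ?scale1r // gt_eqF.
- apply: (@shift_operator_eq (L \o M) idfun) => // [|i];
  first exact: comp_bounded.
  by rewrite /= Me linearZ /= Le subrK scalerA mulVf ?scale1r // gt_eqF.
Qed.

End shift_operators.

(** * The operator norm as a supremum *)

Section operator_norm.
Variables (R : realType) (H : completeNormedModType R).

Lemma opnorm_ub (f : H -> H) C :
  (forall x, `|x| <= 1 -> `|f x| <= C) -> opnorm f <= C.
Proof.
move=> fC; apply: ge_sup; first by exists `|f 0|, 0 => //=; rewrite normr0.
by move=> _ [x x1 <-]; exact: fC.
Qed.

Lemma le_opnorm (f : H -> H) K x :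
  (forall x, `|f x| <= K * `|x|) -> `|x| <= 1 -> `|f x| <= opnorm f.
Proof.
move=> fK x1; apply: ub_le_sup; last by exists x.
exists `|K| => _ [y /= y1 <-]; apply: le_trans (fK y) _.
apply: (@le_trans _ _ (`|K| * `|y|)); first by rewrite ler_wpM2r // ler_norm.
by rewrite ler_piMr.
Qed.

End operator_norm.

(** * Guided pairs, and norms of products in terms of weights *)

Section weighted_pairs.
Variables (R : realType) (H : completeNormedModType R) (ip : {dot H for idfun}).
Variable e : int -> H.
Hypothesis ip_norm : hilbert_product ip.
Hypothesis e_basis : orthonormal_basis ip e.

(** The coefficients are only existentially given in [weighted_pairs]; being positive, they are
    recovered as norms, see [weightE]. *)
Definition weight (p : opair H) (b : bool) (i : int) : R := `|op_of p b (e i)|.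

(** The coefficient of the product along [u] at [e i]: the letter of rank [k] acts when the vector
    has reached site [i + k]. *)
Definition word_weight (p : opair H) (u : seq bool) (i : int) : R :=
  \prod_(k < size u) weight p (nth false u k) (i + k%:Z).

Lemma word_weight_rcons p u b i :
  word_weight p (rcons u b)
    i = word_weight p u i * weight p b (i + (size u)%:Z).
Proof.
rewrite /word_weight size_rcons big_ord_recr /= nth_rcons ltnn eqxx.
by congr (_ * _); apply: eq_bigr => k _; rewrite nth_rcons ltn_ord.
Qed.

Definition guided_pairs (z : int -> bool) : set (opair H) :=
  [set p | weighted_pairs e p /\ exists2 g : R, 0 < g &
    forall i, weight p (~~ z i) i + g <= weight p (z i) i].

(** Reverse triangle inequality at the unit vector [e i]. Boundedness of the two operators makes the
    supremum in [opnorm] an upper bound. *)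
Lemma weight_diff (p q : opair H)
  b i : weighted_pairs e p -> weighted_pairs e q ->
  `|weight q b i - weight p b i| <= opnorm (fun x => op_of q b x - op_of p b x).
Proof.
move=> Wp Wq; apply: le_trans (ler_dist_dist _ _) _.
have /bounded_operatorP[K pK] : bounded_operator (op_of p b).
  by case: b => /=; case: Wp => -[? _ _] [? _ _].
have /bounded_operatorP[K' qK] : bounded_operator (op_of q b).
  by case: b {pK} => /=; case: Wq => -[? _ _] [? _ _].
apply: (@le_opnorm _ _ (fun x => op_of q b x - op_of p b x) (K' + K) (e i)).
  by move=> x; rewrite mulrDl; apply: le_trans (ler_normB _ _) _; exact: lerD.
by rewrite (basis_norm ip_norm e_basis).
Qed.

Lemma guided_pairs_open z : open_in_weighted_pairs e (guided_pairs z).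
Proof.
split=> [p []//|p [Wp [g g0 gap]]].
(* Each of the two weights at a site moves by less than [g / 4], which leaves a gap of [g / 2]. *)
exists (g / 4); first by rewrite divr_gt0.
move=> q Wq q1 q2; split=> //; exists (g / 2); first by rewrite divr_gt0.
have close b i : `|weight q b i - weight p b i| < g / 4.
  apply: le_lt_trans (weight_diff b i Wp Wq) _.
  by case: b.
move=> i; have := gap i; have := close (z i) i; have := close (~~ z i) i.
rewrite !ltr_norml => /andP[h1 h2] /andP[h3 h4]; lra.
Qed.

Lemma guided_pairs_nonempty z : guided_pairs z !=set0.
Proof.
pose a b i : R := if b == z i then 2 else 1.
have aC b i : 1 <= a b i <= 2 by rewrite /a; case: eqP => _; lra.
have [L0 [L0b L0i L0e]] :=
  weighted_shift_exists ip_norm e_basis ltr01 (aC false).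
have [L1 [L1b L1i L1e]] :=
  weighted_shift_exists ip_norm e_basis ltr01 (aC true).
have wE b i : weight (L0, L1) b i = a b i.
  rewrite /weight; case: b => /=; rewrite ?L0e ?L1e normrZ.
    rewrite (basis_norm ip_norm e_basis) mulr1 ger0_norm //.
    by apply: le_trans ler01 _; case/andP: (aC true i).
  rewrite (basis_norm ip_norm e_basis) mulr1 ger0_norm //.
  by apply: le_trans ler01 _; case/andP: (aC false i).
exists (L0, L1); split.
  split; split => //=; [exists (a false)|exists (a true)]; split=> // i.
    by apply: lt_le_trans ltr01 _; case/andP: (aC false i).
  by apply: lt_le_trans ltr01 _; case/andP: (aC true i).
exists 1 => // i; rewrite !wE /a eqxx.
by case: (z i) => /=; lra.
Qed.

Section one_pair.
Variable p : opair H.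
Hypothesis Wp : weighted_pairs e p.

Let op_bounded b : bounded_operator (op_of p b).
Proof. by case: b => /=; case: Wp => -[? _ _] [? _ _]. Qed.

Lemma weightE b i : op_of p b (e i) = weight p b i *: e (i + 1).
Proof.
have [a [a0 aE]] : positive_weighted_shift e (op_of p b).
  by case: b => /=; case: Wp => -[_ _ ?] [_ _ ?].
rewrite /weight aE normrZ (basis_norm ip_norm e_basis) mulr1 gtr0_norm //.
Qed.

(** The upper bound is boundedness; the lower one applies a bounded inverse to the image of [e i], a
    vector of norm [1]. *)
Lemma weight_bounds : exists c C, 0 < c /\ forall b i, c <= weight p b i <= C.
Proof.
have one b : exists c C, 0 < c /\ forall i, c <= weight p b i <= C.
  have /bounded_operatorP[C LC] := op_bounded b.
  have [M [/bounded_operatorP[K MK] LM _]] : invertible_operator (op_of p b).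
    by case: b {LC} => /=; case: Wp => -[_ ? _] [_ ? _].
  exists (1 + `|K|)^-1, C; split; first by rewrite invr_gt0 ltr_pwDl.
  move=> i; apply/andP; split; last first.
    by apply: le_trans (LC _) _; rewrite (basis_norm ip_norm e_basis) mulr1.
  rewrite -div1r ler_pdivrMr ?ltr_pwDl //.
  have {1}-> : 1 = `|e i| by rewrite (basis_norm ip_norm e_basis).
  rewrite -{1}(LM (e i)); apply: le_trans (MK _) _.
  rewrite mulrC ler_wpM2l //; have := ler_norm K; lra.
have [c0 [C0 [c00 h0]]] := one false.
have [c1 [C1 [c10 h1]]] := one true.
exists (Num.min c0 c1), (Num.max C0 C1); split; first by rewrite lt_min c00.
move=> b i; rewrite ge_min le_max.
by case: b; [have /andP[-> ->] := h1 i|have /andP[-> ->] := h0 i];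
  rewrite ?orbT.
Qed.

(** [op_prod] is a bare function; it is identified here with a bounded linear operator to which
    [diagonal_shift_bound] applies. *)
Lemma op_prod_linear u : exists T : {linear H -> H}, [/\ op_prod p u = T,
  bounded_operator T & forall i, T (e i)
    = word_weight p u i *: e (i + (size u)%:Z)].
Proof.
elim/last_ind: u => [|u b [T [TE Tb Te]]].
  exists idfun; split=> //; first by apply/bounded_operatorP; exists 1 => x;
    rewrite mul1r.
  by move=> i; rewrite /word_weight big_ord0 scale1r addr0.
exists (op_of p b \o T); split.
- by rewrite /op_prod foldl_rcons -/(op_prod p u) TE.
- have /bounded_operatorP[K LK] := op_bounded b.
  have /bounded_operatorP[K' TK] := Tb.
  apply/bounded_operatorP; exists (`|K| * K') => x /=.
  apply: le_trans (LK _) _; apply: (@le_trans _ _ (`|K| * `|T x|)).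
    by rewrite ler_wpM2r // ler_norm.
  by rewrite -mulrA ler_wpM2l.
- move=> i; rewrite /= Te linearZ /= weightE scalerA word_weight_rcons
  size_rcons.
  by rewrite intS -addrA [1 + _]addrC.
Qed.

Lemma word_weight_ge0 u i : 0 <= word_weight p u i.
Proof. by apply: prodr_ge0 => k _; exact: normr_ge0. Qed.

(** Together with [opnorm_word_le]: the norm of a product is the supremum of its word weights over
    the starting site. *)
Lemma word_weight_le u i : word_weight p u i <= opnorm (op_prod p u).
Proof.
have [T [-> /bounded_operatorP[K TK] Te]] := op_prod_linear u.
have <- : `|T (e i)| = word_weight p u i.
  by rewrite Te normrZ (basis_norm ip_norm e_basis)
    mulr1 ger0_norm // word_weight_ge0.
by apply: (le_opnorm TK); rewrite (basis_norm ip_norm e_basis).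
Qed.

Lemma opnorm_word_le u C : (forall i, word_weight p u i <= C) ->
  opnorm (op_prod p u) <= C.
Proof.
move=> uC; have [T [-> Tb Te]] := op_prod_linear u.
have C0 : 0 <= C by apply: le_trans (uC 0); exact: word_weight_ge0.
apply: opnorm_ub => x x1.
apply: le_trans (diagonal_shift_bound ip_norm e_basis Tb Te (C := C) _ x) _.
  by move=> i; rewrite ger0_norm ?word_weight_ge0.
by rewrite ler_piMr.
Qed.

End one_pair.
End weighted_pairs.

(** * Growth of guided products *)

Lemma Rintegral_const (R : realType) (nu : probability (borel Sigma2) R)
  (c : R) :
  \int[nu]_x c = c.
Proof.
have nu1 : fine (nu setT) = 1.
  by rewrite (_ : nu setT = 1%E) //; exact: probability_setT.
by rewrite Rintegral_cst // nu1 mulr1.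
Qed.

(** Moving a window by one site exchanges two terms, each at most [K] in absolute value. *)
Lemma window_shift (R : realType) (D : int -> R) (K : R) n :
  (forall i, `|D i| <= K) -> forall i j,
  `|\sum_(k < n) D (i + k%:Z) - \sum_(k < n)
    D (j + k%:Z)| <= 2 * K * (absz (i - j))%:R.
Proof.
move=> DK; pose S i := \sum_(k < n) D (i + k%:Z).
have step i : `|S (i + 1) - S i| <= 2 * K.
  have -> : S (i + 1) - S i = D (i + n%:Z) - D i.
    have -> : D (i + n%:Z) - D i = \sum_(0 <= k < n) (D (i + k.+1%:Z)
      - D (i + k%:Z)).
      by rewrite (telescope_sumr (fun k : nat => D (i + k%:Z))) // addr0.
    rewrite /S -sumrB big_mkord; apply: eq_bigr => k _.
    by rewrite intS addrA.
  have := ler_normB (D (i + n%:Z)) (D i); have := DK (i + n%:Z); have := DK i;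
    lra.
have pos j m : `|S (j + m%:Z) - S j| <= 2 * K * m%:R.
  elim: m => [|m IHm]; first by rewrite addr0 subrr normr0 mulr0.
  have -> : S (j + m.+1%:Z) - S j =
      (S (j + m%:Z + 1) - S (j + m%:Z)) + (S (j + m%:Z) - S j).
    by rewrite addrA subrK intS [1 + _]addrC addrA.
  apply: le_trans (ler_normD _ _) _;
    rewrite -[m.+1]addn1 natrD mulrDr mulr1 addrC.
  exact: lerD.
move=> i j; rewrite -/(S i) -/(S j).
have [ij|ji] := leP j i.
  have E : j + (absz (i - j))%:Z = i by lia.
  by have := pos j (absz (i - j)); rewrite E.
have E : i + (absz (i - j))%:Z = j by lia.
by have := pos i (absz (i - j)); rewrite E distrC.
Qed.

(** The common limit is the infimum of [t] over positive indices. The last hypothesis puts every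
    [a n] above it, and for [n] with [t n] close to it forces [t N <= t n + d] for all large [N]. *)
Lemma squeezed_limits (R : realType) (a t : nat -> R) (c : R) :
  (forall n, (0 < n)%N -> a n <= t n) -> (forall n, c <= t n) ->
  (forall n d, (0 < n)%N -> 0 < d -> exists N0, forall N, (N0 <= N)%N -> t N <=
    a n + d) ->
  exists l : R, t @ \oo --> l /\ a @ \oo --> l.
Proof.
move=> at_ ct key.
pose T := [set t n | n in [set n | (0 < n)%N]].
have T_lb : has_lbound T by exists c => _ [n _ <-].
have T0 : T !=set0 by exists (t 1%N), 1%N.
have infT n : (0 < n)%N -> inf T <= t n by move=> n0; apply: ge_inf => //;
  exists n.
have infa n : (0 < n)%N -> inf T <= a n.
  move=> n0; apply/ler_addgt0Pr => d d0; have [N0 N0P] := key n d n0 d0.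
  by apply: le_trans (N0P N0.+1 (leqnSn _)); exact: infT.
have t_cvg : t @ \oo --> inf T.
  apply/cvgrPdist_le => d d0.
  have [_ [n n0 <-] tn] := inf_adherent (divr_gt0 d0 (ltr0Sn R 1))
    (conj T0 T_lb).
  have [N0 N0P] := key n (d / 2) n0 (divr_gt0 d0 (ltr0Sn R 1)).
  exists N0.+1 => // N /= N0N; rewrite distrC ger0_norm ?subr_ge0; last first.
    by apply: infT; exact: leq_trans N0N.
  have := N0P N (ltnW N0N); have := at_ n n0; rewrite lerBlDr; lra.
exists (inf T); split=> //.
apply: (squeeze_cvgr _ (cvg_cst (inf T)) t_cvg).
by exists 1%N => // n /= n0; rewrite infa // at_.
Qed.

Lemma depends_on_prefix n T (F : seq bool -> T) :
  depends_on [seq i%:Z | i <- iota 1 n] (fun x => F (prefix_word x n)).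
Proof.
move=> x y xy; congr F; apply/eq_in_map => i ni; apply: xy.
exact: (map_f (fun i : nat => i%:Z)).
Qed.

Lemma nth_prefix_word x n k : (k < n)%N ->
  nth false (prefix_word x n) k = x k.+1%:Z.
Proof. by move=> kn; rewrite (nth_map 0%N) ?size_iota // nth_iota // add1n. Qed.

Lemma size_prefix_word x n : size (prefix_word x n) = n.
Proof. by rewrite size_map size_iota. Qed.

(** Prefix words start at site [1], hence the translation by [i - 1] to read the window of [z] that
    starts at [i]. *)
Lemma shiftz_window z (i : int) (k : nat) :
  shiftz (i - 1) z k.+1%:Z = z (i + k%:Z).
Proof. by rewrite /shiftz; congr (z _); lia. Qed.

Section guided_growth.
Variables (R : realType) (mu : probability (borel Sigma2) R).
Hypothesis mu_inv : invariant_measure shift_map mu.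
Hypothesis supp_ue : uniquely_ergodic R (support_map mu_inv).
Variable z : Sigma2.
Hypothesis z_supp : measure_support mu z.
(** [lw] stands for the logarithms of the weights and [f] for the logarithm of the norm of a
    product; [f_ge] and [f_le] make [f u] the supremum of the sums along [u]. *)
Variables (lw : bool -> int -> R) (K h : R) (f : seq bool -> R).
Hypothesis lwK : forall b i, `|lw b i| <= K.
Hypothesis h_gt0 : 0 < h.
Hypothesis lw_gap : forall i, lw (~~ z i) i + h <= lw (z i) i.

Let word_sum (u : seq bool) (i : int) : R :=
  \sum_(k < size u) lw (nth false u k) (i + k%:Z).

Hypothesis f_ge : forall u i, word_sum u i <= f u.
Hypothesis f_le : forall u a, (forall i, word_sum u i <= a) -> f u <= a.

Let path n (i : int) : R := \sum_(k < n) lw (z (i + k%:Z)) (i + k%:Z).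

(** By [f_le_top] and [path_le_f] this is the largest value of [f] on words of length [n]. *)
Definition top_growth n : R := sup (range (path n)).

Let K_ge0 : 0 <= K. Proof. exact: le_trans (lwK false 0). Qed.

Let norm_path n i : `|path n i| <= n%:R * K.
Proof.
apply: le_trans (ler_norm_sum _ _ _) _.
apply: (@le_trans _ _ (\sum_(k < n) K)); first exact: ler_sum.
by rewrite sumr_const card_ord mulr_natl.
Qed.

Lemma path_le_top n i : path n i <= top_growth n.
Proof.
apply: ub_le_sup; last by exists i.
exists (n%:R * K) => _ [j _ <-].
by apply: le_trans (norm_path n j); exact: ler_norm.
Qed.

Lemma top_growth_le n a : (forall i, path n i <= a) -> top_growth n <= a.
Proof.
move=> pa; apply: ge_sup; first by exists (path n 0), 0.
by move=> _ [i _ <-].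
Qed.

Let prefix_sum x n i :
  word_sum (prefix_word x n) i = \sum_(k < n) lw (x k.+1%:Z) (i + k%:Z).
Proof.
rewrite /word_sum size_prefix_word; apply: eq_bigr => k _.
by rewrite nth_prefix_word.
Qed.

Lemma path_le_f n i : path n i <= f (prefix_word (shiftz (i - 1) z) n).
Proof.
apply: le_trans (f_ge _ i); rewrite prefix_sum le_eqVlt; apply/orP; left;
  apply/eqP.
by apply: eq_bigr => k _; rewrite shiftz_window.
Qed.

Lemma f_le_top u : f u <= top_growth (size u).
Proof.
apply: f_le => i; apply: le_trans (path_le_top _ i); apply: ler_sum => k _.
case: (eqVneq (nth false u k) (z (i + k%:Z))) => [-> //|nz].
have -> : nth false u k = ~~ z (i + k%:Z) by move: nz; case: (nth _ _ _);
  case: (z (i + _)).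
by have := lw_gap (i + k%:Z); have := h_gt0; lra.
Qed.

(** Choose [i] with the fewest mismatches. From any starting site [j] the sum along the word falls
    short of the path of [z] by at least [h] per mismatch, hence by [h] times that minimum; [f_le]
    passes to the supremum over [j]. *)
Lemma f_mismatch (x : Sigma2) n : exists i : int,
  h * \sum_(k < n) (x k.+1%:Z != z (i + k%:Z))%:R <=
  top_growth n - f (prefix_word x n).
Proof.
pose M (i : int) : nat := (\sum_(k < n) (x k.+1%:Z != z (i + k%:Z)%R))%N.
have exM : exists m, `[< exists i : int, M i = m >] by exists (M 0);
  apply/asboolP; exists 0.
case: (ex_minnP exM) => m /asboolP[i Mi] m_min.
exists i; rewrite lerBrDr -lerBrDl; apply: f_le => j.
have Mj : (m <= M j)%N by apply: m_min; apply/asboolP; exists j.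
rewrite prefix_sum -natr_sum -/(M i) Mi.
apply: (@le_trans _ _ (path n j - h * (M j)%:R)); last first.
  apply: lerB; first exact: path_le_top.
  by rewrite ler_wpM2l ?(ltW h_gt0) // ler_nat.
rewrite /M natr_sum mulr_sumr /path -sumrB; apply: ler_sum => k _.
case: (eqVneq (x k.+1%:Z) (z (j + k%:Z))) => [-> |nz];
  first by rewrite mulr0 subr0.
have -> : x k.+1%:Z = ~~ z (j + k%:Z) by move: nz; case: (x _);
  case: (z (j + _)).
by have := lw_gap (j + k%:Z); rewrite mulr1; lra.
Qed.

Definition mean_growth (nu : probability (borel Sigma2) R) n : R :=
  n%:R^-1 * \int[nu]_x f (prefix_word x n).

Let f_integrable (nu : probability (borel Sigma2) R) n :
  nu.-integrable setT (EFin \o (fun x : borel Sigma2 => f (prefix_word x n))).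
Proof. exact: depends_on_integrable (@depends_on_prefix n R f). Qed.

Lemma mean_growth_le nu n : mean_growth nu n <= n%:R^-1 * top_growth n.
Proof.
rewrite /mean_growth ler_wpM2l ?invr_ge0 //.
have -> : top_growth n = \int[nu]_x (top_growth n).
  by rewrite Rintegral_const.
apply: le_Rintegral => //.
- exact: f_integrable.
- exact: (@depends_on_integrable _ _ [::] (cst (top_growth n))).
- by move=> x _; have := f_le_top (prefix_word x n); rewrite size_prefix_word.
Qed.

(* Averaging over the windows of length [n] of a long stretch of [z], whose
   letter frequencies are those of [mu] by unique ergodicity. *)
Lemma top_growth_le_mean n d : (0 < n)%N -> 0 < d -> exists N0, forall N,
  (N0 <= N)%N -> N%:R^-1 * top_growth N <= mean_growth mu n + d.
Proof.
move=> n0 d0; have n0' : 0 < n%:R :> R by rewrite ltr0n.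
have nd : 0 < n%:R * (d / 2) by rewrite mulr_gt0 // divr_gt0.
have [N0 N0P] := uniform_average supp_ue (@depends_on_prefix n R f) nd.
(* For [N >= N1] the boundary error [2 * K * n] is at most [N * d / 2]; the other half of [d] pays
   for the uniform average. *)
have [N1 N1P] : exists N1 : nat, 4 * K * n%:R / d < N1%:R.
  by exists (Num.bound (4 * K * n%:R / d)); apply: archi_boundP;
    rewrite divr_ge0 ?mulr_ge0 // ltW.
exists (maxn 1 (maxn N0 N1)) => N; rewrite !geq_max => /and3P[N_gt0 N0N N1N].
have N0' : 0 < N%:R :> R by rewrite ltr0n.
rewrite ler_pdivrMl //; apply: top_growth_le => i.
pose F x := f (prefix_word x n).
have y_supp : measure_support mu (shiftz (i - 1) z) by exact: support_shiftz.
have lower : \sum_(j < N) path n (i + j%:Z)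
  <= N%:R * birkhoff_avg shift_map F N (shiftz (i - 1) z).
  rewrite /birkhoff_avg mulVKf ?gt_eqF //; apply: ler_sum => j _.
  apply: le_trans (path_le_f _ _) _; rewrite /F iter_shift.
  rewrite (_ : shiftz (i + j%:Z - 1) z = shiftz j%:Z (shiftz (i - 1) z)) //.
  by apply/funext => k; rewrite /shiftz; congr (z _); lia.
(* Double counting: the [N] windows of length [n] are regrouped into [n] windows of length [N], all
   close to [path N i] by [window_shift]. *)
have swap : \sum_(j < N) path n (i + j%:Z) = \sum_(k < n) path N (i + k%:Z).
  rewrite /path exchange_big /=; apply: eq_bigr => k _; apply: eq_bigr => j _.
  by rewrite -!addrA [j%:Z + _]addrC.
have upper : n%:R * path N i - n%:R * (2 * K * n%:R) <= \sum_(k < n)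
  path N (i + k%:Z).
  have -> : n%:R * path N i - n%:R * (2 * K * n%:R) =
      \sum_(k < n) (path N i - 2 * K * n%:R).
    by rewrite sumr_const card_ord -[RHS]mulr_natl mulrBr.
  apply: ler_sum => k _.
  have := @window_shift R (fun i => lw (z i) i) K N (fun i =>
    lwK _ _) i (i + k%:Z).
  rewrite opprD addrA subrr add0r abszN absz_nat -/(path N i)
    -/(path N (i + k%:Z)).
  have : 2 * K * k%:R <= 2 * K * n%:R.
    by rewrite ler_wpM2l ?mulr_ge0 // ler_nat ltnW.
  by rewrite ler_norml => h1 /andP[h2 h3]; lra.
have := N0P N _ N0N y_supp; rewrite ler_norml => /andP[_ avg].
have {}avg : N%:R * birkhoff_avg shift_map F N (shiftz (i - 1) z) <=
    N%:R * (n%:R * mean_growth mu n + n%:R * (d / 2)).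
  by rewrite ler_wpM2l // /mean_growth mulVKf ?gt_eqF // -lerBlDl.
have NK : 4 * K * n%:R <= d * N%:R.
  rewrite [leRHS]mulrC -ler_pdivrMr //; apply: le_trans (ltW N1P) _.
  by rewrite ler_nat.
rewrite -(ler_pM2l n0').
have : n%:R * (4 * K * n%:R) <= n%:R * (d * N%:R) by rewrite ler_wpM2l // ltW.
move: lower; rewrite swap => lower.
have := le_trans upper (le_trans lower avg).
set m := mean_growth mu n; set P := path N i.
nra.
Qed.

Lemma growth_limit : exists l : R, n%:R^-1 * top_growth n @[n --> \oo] --> l /\
  mean_growth mu n @[n --> \oo] --> l.
Proof.
apply: (@squeezed_limits _ _ _ (- K)) => [n _|n|n d n0 d0].
- exact: mean_growth_le.
- case: n => [|n]; first by rewrite invr0 mul0r oppr_le0.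
  rewrite ler_pdivlMl //; apply: le_trans (path_le_top _ 0).
  by have := norm_path n.+1 0; rewrite ler_norml mulrN => /andP[].
- exact: top_growth_le_mean.
Qed.

(** Compare [x] with its closest window [y] of [z]: each mismatch affects at most [size s] terms of
    the Birkhoff sum and costs [h] in growth. After integration [|nu A - mu A|] is at most
    [d + O(1/n)] plus a multiple of the growth deficit of [nu], which tends to [0]. *)
Lemma maximal_growth_frequency (nu : probability (borel Sigma2) R) s
    (A : set Sigma2) (l : R) :
  invariant_measure shift_map nu -> depends_on s A ->
  n%:R^-1 * top_growth n @[n --> \oo] --> l ->
  mean_growth nu n @[n --> \oo] --> l -> fine (nu A) = fine (mu A).
Proof.
move=> nu_inv sA t_cvg nu_cvg.
(* The total cost, by [window_shift] with [K = 1], of moving the windows that start at the sites of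
   [s] to the one that starts at [1]. *)
pose cs : R := \sum_(i <- s) 2 * (absz (i - 1))%:R.
pose B n (x : Sigma2) := birkhoff_avg shift_map (\1_A : Sigma2 -> R) n x.
have B_close n x : (0 < n)%N -> exists2 y, measure_support mu y &
    `|B n x - B n y| <= n%:R^-1 * cs + (size s)%:R / h *
      (n%:R^-1 * (top_growth n - f (prefix_word x n))).
  move=> n0; have n0' : 0 < n%:R :> R by rewrite ltr0n.
  have [i Mi] := f_mismatch x n.
  pose y := shiftz (i - 1) z.
  exists y; first exact: support_shiftz.
  pose D j : R := (x j != y j)%:R.
  have DM : h * \sum_(k < n) D (1 + k%:Z) <= top_growth n - f (prefix_word x n).
    apply: le_trans Mi; rewrite ler_wpM2l ?(ltW h_gt0) //;
      apply: ler_sum => k _.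
    by rewrite /D /y -intS shiftz_window.
  have B_D : `|B n x - B n y| <= n%:R^-1 * \sum_(j < n) \sum_(i <- s)
    D (i + j%:Z).
    rewrite /B /birkhoff_avg -mulrBr normrM ger0_norm ?invr_ge0 // ler_wpM2l
      ?invr_ge0 //.
    rewrite -sumrB; apply: le_trans (ler_norm_sum _ _ _) _;
      apply: ler_sum => j _.
    (* If [x] and [y] agree at all sites read at time [j], the indicators agree; otherwise they
       differ by at most [1] and some [D (k + j)] equals [1]. *)
    have [allD|/allPn[k sk Dk]] :=
      boolP (all (fun k => x (k + j%:Z) == y (k + j%:Z)) s).
      rewrite (depends_on_indic R sA (x := iter j shift_map x) (y :=
        iter j shift_map y)).
        by rewrite subrr normr0; apply: sumr_ge0 => k _; rewrite /D.
      by move=> k sk; rewrite !iter_shift_map; apply/eqP; exact: (allP allD).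
    apply: (@le_trans _ _ 1).
      rewrite !indicE; do 2! case: (_ \in A);
        rewrite ?subrr ?subr0 ?sub0r ?normrN;
      by rewrite ?normr0 ?normr1.
    rewrite (big_rem k) //= {1}/D Dk lerDl; apply: sumr_ge0 => k' _.
    by rewrite /D.
  apply: le_trans B_D _; rewrite mulrCA -mulrDr ler_wpM2l ?invr_ge0 //.
  rewrite exchange_big /=.
  apply: (@le_trans _ _ (\sum_(i <- s) (2 * (absz (i - 1))%:R + \sum_(k < n)
    D (1 + k%:Z)))).
    apply: ler_sum => k _; rewrite -lerBlDr.
    have := @window_shift R D 1 n _ k 1; rewrite mulr1 => ws.
    apply: le_trans (ws _); first exact: ler_norm.
    by move=> j; rewrite /D ger0_norm // lern1 leq_b1.
  rewrite big_split /= -/cs lerD2l big_const_seq count_predT iter_addr_0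
    -[leLHS]mulr_natl.
  rewrite -mulrA ler_wpM2l //.
  by rewrite ler_pdivlMl.
have freq d : 0 < d -> exists N0, forall n, (N0 <= n)%N ->
    `|fine (nu A) - fine (mu A)| <= d + n%:R^-1 * cs + (size s)%:R / h *
      (n%:R^-1 * top_growth n - mean_growth nu n).
  move=> d0; have [N0 N0P] := uniform_frequency supp_ue sA d0.
  exists N0.+1 => n N0n; have n0 : (0 < n)%N by exact: leq_trans N0n.
  have sB := @depends_on_birkhoff R s \1_A n (depends_on_indic R sA).
  have cst_int (c : R) : nu.-integrable setT (EFin \o (cst c : borel Sigma2 ->
    R)).
    exact: (@depends_on_integrable _ _ [::] (cst c)).
  rewrite -(Rintegral_birkhoff_indic nu_inv sA n0).
  have -> : fine (mu A) = \int[nu]_x (fine (mu A)) by rewrite Rintegral_const.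
  rewrite -RintegralB //; [|exact: depends_on_integrable sB|exact: cst_int].
  have sBA : depends_on [seq i + j%:Z | i <- s, j <- iota 0 n]
      (fun x => B n x - fine (mu A)) by move=> x y xy; rewrite /B (sB x y xy).
  have snBA : depends_on [seq i + j%:Z | i <- s, j <- iota 0 n]
      (fun x => `|B n x - fine (mu A)|) by move=> x y xy;
        rewrite /B (sB x y xy).
  apply: le_trans (le_normr_Rintegral _ _) _ => //;
    first exact: depends_on_integrable sBA.
  pose c1 := d + n%:R^-1 * cs + (size s)%:R / h * (n%:R^-1 * top_growth n).
  pose c2 := (size s)%:R / h * n%:R^-1.
  have sc2 : depends_on [seq i%:Z | i <- iota 1 n] (fun x =>
    c2 * f (prefix_word x n)).
    exact: (@depends_on_prefix n R (fun u => c2 * f u)).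
  have sc12 : depends_on [seq i%:Z | i <- iota 1 n] (fun x =>
    c1 - c2 * f (prefix_word x n)).
    exact: (@depends_on_prefix n R (fun u => c1 - c2 * f u)).
  apply: (@le_trans _ _ (\int[nu]_x (c1 - c2 * f (prefix_word x n)))).
    apply: le_Rintegral => //.
    - exact: depends_on_integrable snBA.
    - exact: depends_on_integrable sc12.
    - move=> x _; have [y Zy xy] := B_close n x n0.
      have yA := N0P n y (ltnW N0n) Zy.
      have -> : B n x - fine (mu A) = (B n x - B n y) + (B n y - fine (mu A)).
        by rewrite addrA subrK.
      apply: le_trans (ler_normD _ _) _; apply: le_trans (lerD xy yA) _.
      rewrite /c1 /c2 !mulrBr !mulrA; lra.
  rewrite RintegralB //; [|exact: cst_int|exact: depends_on_integrable sc2].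
  rewrite Rintegral_const RintegralZl //; last exact: f_integrable.
  by rewrite /c1 /c2 /mean_growth mulrBr !mulrA addrA.
apply/eqP; rewrite -subr_eq0 -normr_le0; apply/ler_addgt0Pr => d d0;
  rewrite add0r.
have [N0 N0P] := freq d d0.
have lim_d : d + n%:R^-1 * cs + (size s)%:R / h *
      (n%:R^-1 * top_growth n - mean_growth nu n) @[n --> \oo] --> d.
  rewrite -[X in _ --> X]addr0 -[in X in _ --> X](mulr0 ((size s)%:R / h)).
  apply: cvgD; last first.
    by apply: cvgMr; rewrite -[X in _ --> X](subrr l); exact: cvgB.
  rewrite -[X in _ --> X]addr0 -[in X in _ --> X](mul0r cs).
  apply: cvgD; first exact: cvg_cst.
  apply: cvgMl; rewrite -(cvg_shiftS (fun n : nat => n%:R^-1 : R)).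
  exact: cvg_harmonic.
rewrite -(cvg_lim _ lim_d) //.
apply: limr_ge; first by apply/cvg_ex; exists d.
by exists N0 => // n /= N0n; exact: N0P.
Qed.

End guided_growth.

(** * Joint spectral radius and maximising measures *)

(** Cylinders are closed under intersection and generate the Borel sets. *)
Lemma measure_eq_cylinders (R : realType) (mu nu : probability (borel Sigma2)
  R) :
  (forall l, fine (nu (cylinder l)) = fine (mu (cylinder l)))
    -> same_measure nu mu.
Proof.
move=> numu A mA.
have mC l : measurable (cylinder l : set (borel Sigma2)).
  by apply: sub_sigma_algebra; exact: open_cylinder.
have gA : <<s range cylinder >> A.
  move: A mA; apply: smallest_sub; first exact: smallest_sigma_algebra.
  apply: (@cylinder_gen Sigma2 id) => [x U xU|l]; first by exists U.
  by exists l.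
apply: (@g_sigma_algebra_measure_unique _ R (borel Sigma2) (range cylinder) _
  (fun=> setT) _ _ nu mu) => //.
- by move=> _ [l _ <-].
- by move=> _; exists [::] => //; apply/seteqP; split.
- by rewrite bigcup_const.
- move=> _ _ [l _ <-] [k _ <-]; exists (l ++ k) => //.
  apply/seteqP; split => x; rewrite /cylinder /= all_cat; first by move/andP.
  by move=> [? ?]; apply/andP.
- move=> _ [l _ <-]; rewrite -[LHS]fineK ?fin_num_measure // -[RHS]fineK
  ?fin_num_measure //.
  by rewrite numu.
- by move=> _; apply: le_lt_trans (probability_le1 nu measurableT) _;
  rewrite ltry.
Qed.

(** * Logarithmic weights and norms of a guided pair *)

Section guided_pair.
Variables (R : realType) (H : completeNormedModType R) (ip : {dot H for idfun}).
Variable e : int -> H.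
Hypothesis ip_norm : hilbert_product ip.
Hypothesis e_basis : orthonormal_basis ip e.
Variables (z : Sigma2) (p : opair H).
Hypothesis p_guided : guided_pairs e z p.

Let Wp : weighted_pairs e p. Proof. by case: p_guided. Qed.

Definition log_weight (b : bool) (i : int) : R := ln (weight e p b i).

Definition log_norm (u : seq bool) : R := ln (opnorm (op_prod p u)).

Let weight_gt0 b i : 0 < weight e p b i.
Proof.
have [c [C [c0 cC]]] := weight_bounds ip_norm e_basis Wp.
by case/andP: (cC b i) => h _; exact: lt_le_trans h.
Qed.

Lemma log_weight_bounded : exists K : R, forall b i, `|log_weight b i| <= K.
Proof.
have [c [C [c0 cC]]] := weight_bounds ip_norm e_basis Wp.
exists (`|ln c| + `|ln C|) => b i; have /andP[cw wC] := cC b i.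
have C0 : 0 < C by apply: lt_le_trans wC.
have : ln c <= log_weight b i by rewrite ler_ln ?posrE.
have : log_weight b i <= ln C by rewrite ler_ln ?posrE.
have := ler_norm (ln C); have := ler_norm (- ln c).
have := normr_ge0 (ln C); have := normr_ge0 (ln c).
rewrite normrN ler_norml => *; apply/andP; split; lra.
Qed.

(** The additive gap [g] becomes multiplicative: a weight [w <= C] satisfies
    [w * (1 + g / C) <= w + g]. *)
Lemma log_weight_gap : exists2 h : R, 0 < h &
  forall i, log_weight (~~ z i) i + h <= log_weight (z i) i.
Proof.
have [c [C [c0 cC]]] := weight_bounds ip_norm e_basis Wp.
have [_ [g g0 gap]] := p_guided.
have C0 : 0 < C by case/andP: (cC true 0) => h; apply: lt_le_trans;
  exact: lt_le_trans h.
have gC : 0 < g / C by exact: divr_gt0.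
exists (ln (1 + g / C)); first by rewrite ln_gt0 // ltrDl.
move=> i; rewrite -lnM ?posrE // ?addr_gt0 // ler_ln ?posrE ?mulr_gt0 ?addr_gt0
  //.
apply: le_trans (gap i); rewrite mulrDr mulr1 lerD2l mulrCA -ler_pdivlMl //.
by rewrite mulVf ?gt_eqF // ler_pdivrMr // mul1r; case/andP: (cC (~~ z i) i).
Qed.

Let word_sum (u : seq bool) (i : int) : R :=
  \sum_(k < size u) log_weight (nth false u k) (i + k%:Z).

Lemma word_weightE u i : word_weight e p u i = expR (word_sum u i).
Proof.
rewrite /word_sum expR_sum; apply: eq_bigr => k _.
by rewrite /log_weight lnK // posrE.
Qed.

Lemma opnorm_word_gt0 u : 0 < opnorm (op_prod p u).
Proof.
apply: lt_le_trans (word_weight_le ip_norm e_basis Wp u 0).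
by rewrite word_weightE expR_gt0.
Qed.

Lemma log_norm_ge u i : word_sum u i <= log_norm u.
Proof.
rewrite -ler_expR /log_norm lnK ?posrE ?opnorm_word_gt0 // -word_weightE.
exact: (word_weight_le ip_norm e_basis Wp).
Qed.

Lemma log_norm_le u a : (forall i, word_sum u i <= a) -> log_norm u <= a.
Proof.
move=> ua; rewrite -ler_expR /log_norm lnK ?posrE ?opnorm_word_gt0 //.
apply: (opnorm_word_le ip_norm e_basis Wp) => i.
by rewrite word_weightE ler_expR.
Qed.

(** For [n > 0] the supremum in the definition equals the exponential of [top_growth] divided by
    [n]: [f_le_top] bounds it above, and the words read along [z] bound it below. Continuity of the
    exponential concludes. *)
Lemma ln_joint_spectral_radius (l : R) :
  n%:R^-1 * top_growth z log_weight n @[n --> \oo] --> l ->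
  ln (joint_spectral_radius p) = l.
Proof.
move=> t_cvg; have [K logK] := log_weight_bounded.
have [h h0 gap] := log_weight_gap.
suff -> : joint_spectral_radius p = expR l by rewrite expRK.
apply/cvg_lim => //.
apply: (@cvg_trans _ (expR (n%:R^-1 * top_growth z log_weight n)
  @[n --> \oo])); last first.
  exact: (continuous_cvg _ (@continuous_expR R l) t_cvg).
apply: near_eq_cvg; exists 1%N => // n /= n0.
have n0' : 0 < n%:R :> R by rewrite ltr0n.
pose S := [set opnorm (op_prod p w) `^ n%:R^-1 | w in [set: n.-tuple bool]].
have powE u : opnorm (op_prod p u) `^ n%:R^-1 = expR (n%:R^-1 * log_norm u).
  by rewrite -[in LHS](lnK (x :=
    opnorm _)) ?posrE ?opnorm_word_gt0 // mulrC expRM.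
have S_ub w : S w -> w <= expR (n%:R^-1 * top_growth z log_weight n).
  move=> [u _ <-]; rewrite powE ler_expR ler_wpM2l ?invr_ge0 //.
  by rewrite -[in leRHS](size_tuple u);
    exact: (f_le_top logK h0 gap log_norm_le).
apply/eqP; rewrite eq_le; apply/andP; split; last first.
  by apply: ge_sup => //; exists (opnorm (op_prod p (nseq_tuple n false))
    `^ n%:R^-1), (nseq_tuple n false).
have pathS i : expR (n%:R^-1 * \sum_(k < n) log_weight (z (i + k%:Z))
  (i + k%:Z)) <= sup S.
  pose u := Tuple (introT eqP (size_prefix_word (shiftz (i - 1) z) n)).
  apply: (@le_trans _ _ (opnorm (op_prod p u) `^ n%:R^-1)).
    rewrite powE ler_expR ler_wpM2l ?invr_ge0 //;
      exact: (path_le_f z log_norm_ge).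
  by apply: ub_le_sup; [exists (expR (n%:R^-1 * top_growth z log_weight
    n))|exists u].
(* Positivity allows taking the logarithm of [sup S], so that the bounds for single paths pass to
   [top_growth]. *)
have S0 : 0 < sup S by apply: lt_le_trans (pathS 0); exact: expR_gt0.
rewrite -[leRHS]lnK ?posrE // ler_expR ler_pdivrMl //.
apply: (top_growth_le (z := z) (lw := log_weight)) => i.
by rewrite -ler_pdivrMl // -ler_expR lnK ?posrE.
Qed.

End guided_pair.

Theorem theorem1p3 (R : realType) (H : completeNormedModType R)
    (ip : {dot H for idfun}) (e : int -> H)
    (ip_norm : hilbert_product ip) (e_basis : orthonormal_basis ip e)
    (mu : probability (borel Sigma2) R)
      (mu_inv : invariant_measure shift_map mu)
    (supp_ue : uniquely_ergodic R (support_map mu_inv)) :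
  exists U : set (opair H),
    [/\ U !=set0,
        open_in_weighted_pairs e U &
        forall p : opair H, U p ->
          maximising p mu /\
          forall nu : probability (borel Sigma2) R,
            maximising p nu -> same_measure nu mu].
Proof.
(* Any point of the support can serve as the guide. *)
have [z z_supp] := support_nonempty supp_ue.
exists (guided_pairs e z); split.
- exact: (guided_pairs_nonempty ip_norm e_basis).
- exact: (guided_pairs_open ip_norm e_basis).
move=> p p_guided.
have [K logK] := log_weight_bounded ip_norm e_basis p_guided.
have [h h0 gap] := log_weight_gap ip_norm e_basis p_guided.
have f_ge := log_norm_ge ip_norm e_basis p_guided.
have f_le := log_norm_le ip_norm e_basis p_guided.
have [l [t_cvg mu_cvg]] := growth_limit supp_ue z_supp logK h0 gap f_ge f_le.
have jsr := ln_joint_spectral_radius ip_norm e_basis p_guided t_cvg.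
split; first by split=> //; rewrite jsr; exact: mu_cvg.
move=> nu [nu_inv]; rewrite jsr => nu_cvg.
apply: measure_eq_cylinders => m.
exact: (maximal_growth_frequency supp_ue z_supp logK h0 gap f_le nu_inv
  (@depends_on_cylinder m) t_cvg nu_cvg).
Qed.
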